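(* For every $\eta>0$ there exist $n_0$ and $\gamma>0$ such that the following holds for every $n>n_0$ and every $k>0$. Let $G$ be any graph on $n$ vertices with average degree $\overline{\deg}(G)\ge k+\eta n$. Then $G$ contains (as a subgraph) every tree $T$ on $k$ vertices with maximum degree $\Delta(T)\le \gamma k$.
   Context: $\overline{\deg}(G)=2|E(G)|/|V(G)|$ denotes the average degree of $G$ and $\Delta(T)$ the maximum degree of $T$. *)

(* Defs.v *)
From HB Require Import structures.
From mathcomp Require Import all_boot all_order all_algebra.
From mathcomp Require Import reals.

Set Implicit Arguments.
Unset Strict Implicit.
Unset Printing Implicit Defensive.

Import Order.TTheory GRing.Theory Num.Theory.

Record sgraph := SGraph {
  vertex :> finType;
  adj : rel vertex;
  adj_sym : symmetric adj;
  adj_irrefl : irreflexive adj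
}.

Definition edges (G : sgraph) : {set {set G}} :=
  [set [set p.1; p.2] | p : G * G & adj p.1 p.2].

Definition degree (G : sgraph) (x : G) : nat := #|[set y | adj x y]|.

Definition max_degree (G : sgraph) : nat := \max_(x : G) degree x.

Definition avg_degree (R : realType) (G : sgraph) : R :=
  (2 * #|edges G|%:R / #|G|%:R)%R.

Definition connected_graph (G : sgraph) : Prop :=
  0 < #|G| /\ forall x y : G, connect (@adj G) x y.

(* A cycle of a graph has at least three vertices: [ucycle] also accepts the
   empty sequence and [:: x; y] for an edge xy, which are not cycles. *)
Definition acyclic_graph (G : sgraph) : Prop :=
  forall c : seq G, ucycle (@adj G) c -> size c < 3.

Definition is_tree (G : sgraph) : Prop :=
  connected_graph G /\ acyclic_graph G.

(* Not necessarily induced. *)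
Definition contains_subgraph (G H : sgraph) : Prop :=
  exists2 f : H -> G, injective f & {homo f : x y / adj x y}.

(* Main.v *)
Require Import Defs.
From HB Require Import structures.
From mathcomp Require Import all_boot all_order all_algebra.
From mathcomp Require Import reals.
From mathcomp Require Import ring lra.

Set Implicit Arguments.
Unset Strict Implicit.
Unset Printing Implicit Defensive.

Import Order.TTheory GRing.Theory Num.Theory.
Local Open Scope ring_scope.

(** Regularise G into clusters and keep only the dense regular pairs between
    non-tiny clusters.  Deleting clusters of low degree leaves a reduced graph r
    with a cluster i0 whose neighbours have total size at least k + eta n / 2,
    while each of these neighbours has weighted degree at least half of that.

    Cut T, bipartite with classes of sizes a <= b, into few seeds and many small
    blocks, arranged so that every seed in the larger class has a seed as
    parent.  Seeds and tops of blocks go to a small reserved part of the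
    clusters, those of the smaller class inside i0.  Every other block is put in
    a cell (i, j), where i is a neighbour of i0 and j one of i: its larger class
    goes to i and its smaller class to j.  Linear programming duality gives a
    distribution of cells for which the expected loads fit in the clusters.
    Blocks are embedded one after another, the cell of each being chosen online
    so that the sum of the squared deviations from the expected loads stays
    small; inside a cell, regularity makes a greedy embedding work. *)

(** * Energy of a partition *)

Section ConditionalExpectation.
Variables (R : realFieldType) (Z : finType) (g : Z -> R).

Definition class_avg (K : finType) (k : Z -> K) (i : K) : R :=
  (\sum_(y | k y == i) g y) / #|[pred y | k y == i]|%:R.

(** The squared L2 norm of the conditional expectation of [g] given [k]; summing over points weights
    classes by size, so they may be unequal. *)
Definition energy (K : finType) (k : Z -> K) : R :=
  \sum_z class_avg k (k z) ^+ 2.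

Lemma sum_class_avg (K : finType) (k : Z -> K) (h : K -> R) :
  \sum_z h (k z) * class_avg k (k z) = \sum_z h (k z) * g z.
Proof.
rewrite (partition_big k xpredT) //= [RHS](partition_big k xpredT) //=.
apply: eq_bigr => i _.
have [n0|n0] := eqVneq #|[pred y | k y == i]| 0%N.
  by rewrite !big_pred0 // => z; have := card0_eq n0 z.
transitivity (\sum_(z | k z == i) h i * class_avg k i).
  by apply: eq_bigr => z /eqP ->.
rewrite sumr_const -mulr_natr -mulrA divfK ?pnatr_eq0 // mulr_sumr.
by apply: eq_bigr => z /eqP ->.
Qed.

(** Pythagoras: since [k] factors through [k'], the average over [k] is the projection of the
    average over [k'], and the cross term equals the energy of [k]. *)
Lemma energy_refine (K K' : finType) (k : Z -> K) (k' : Z -> K')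
    (m : K' -> K) : (forall z, k z = m (k' z)) ->
  \sum_z (class_avg k' (k' z) - class_avg k (k z)) ^+ 2
    = energy k' - energy k.
Proof.
move=> km.
have P : \sum_z class_avg k (k z) * class_avg k' (k' z) = energy k.
  transitivity (\sum_z class_avg k (k z) * g z).
    rewrite -[RHS](_ : \sum_z class_avg k (m (k' z)) * g z = _).
      rewrite -(sum_class_avg k' (fun i => class_avg k (m i))).
      by apply: eq_bigr => z _; rewrite km.
    by apply: eq_bigr => z _; rewrite km.
  rewrite -(sum_class_avg k (class_avg k)).
  by apply: eq_bigr => z _; rewrite expr2.
rewrite (_ : energy k' - energy k =
  energy k' - (energy k *+ 2) + energy k); last by rewrite mulr2n; lra.
rewrite -{1}P /energy -sumrMnl -sumrB -big_split /=.
by apply: eq_bigr => z _; rewrite sqrrB [class_avg k' _ * _]mulrC.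
Qed.

Lemma class_avg_ge0_le1 (K : finType) (k : Z -> K) (i : K) :
  (forall z, 0 <= g z <= 1) -> 0 <= class_avg k i <= 1.
Proof.
move=> g01; rewrite /class_avg; apply/andP; split.
  by rewrite divr_ge0 // sumr_ge0 // => z _; case/andP: (g01 z).
have [->|n0] := eqVneq #|[pred y | k y == i]| 0%N; first by rewrite invr0 mulr0.
rewrite ler_pdivrMr ?ltr0n ?lt0n // mul1r -sum1_card natr_sum.
by apply: ler_sum => z _; case/andP: (g01 z).
Qed.

Lemma energy_le (K : finType) (k : Z -> K) :
  (forall z, 0 <= g z <= 1) -> energy k <= #|Z|%:R.
Proof.
move=> g01; rewrite -sum1_card natr_sum; apply: ler_sum => z _.
by have /andP[? ?] := class_avg_ge0_le1 k (k z) g01; rewrite exprn_ile1.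
Qed.

Lemma energy_ge0 (K : finType) (k : Z -> K) : 0 <= energy k.
Proof. by apply: sumr_ge0 => z _; rewrite sqr_ge0. Qed.

Lemma sqr_sum_le (I : finType) (A : {set I}) (F : I -> R) :
  (\sum_(i in A) F i) ^+ 2 <= #|A|%:R * \sum_(i in A) F i ^+ 2.
Proof.
have [->|n0] := eqVneq A set0; first by rewrite !big_set0 expr0n mulr0.
have A0 : 0 < #|A|%:R :> R by rewrite ltr0n card_gt0.
set s := \sum_(i in A) F i; set q := \sum_(i in A) F i ^+ 2.
have : 0 <= \sum_(i in A) (#|A|%:R * F i - s) ^+ 2.
  by apply: sumr_ge0 => i _; rewrite sqr_ge0.
rewrite (eq_bigr (fun i => #|A|%:R ^+ 2 * F i ^+ 2 - (#|A|%:R * s *+ 2) * F i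
  + s ^+ 2)); last by move=> i _; ring.
rewrite big_split sumrB /= sumr_const -!mulr_sumr -/s -/q.
rewrite -[s ^+ 2 *+ _]mulr_natr; set a : R := #|A|%:R in A0 *.
have -> : a ^+ 2 * q - a * s *+ 2 * s + s ^+ 2 * a = a * (a * q - s ^+ 2).
  by ring.
by rewrite pmulr_rge0 // subr_ge0.
Qed.

(* Each set A i sits inside the class i and is a union of classes of k', so
   Cauchy-Schwarz on A i bounds the gain of passing from k to k'. *)
Lemma energy_gain (K K' : finType) (k : Z -> K) (k' : Z -> K')
    (m : K' -> K) (A : K -> {set Z}) (B : K -> {set K'}) (eps : R) :
  (forall z, k z = m (k' z)) ->
  (forall i z, (z \in A i) = (k' z \in B i) && (k z == i)) ->
  0 <= eps ->
  (forall i, \sum_(z in A i) g z <= (class_avg k i - eps) * #|A i|%:R) ->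
  eps ^+ 2 * \sum_i #|A i|%:R <= energy k' - energy k.
Proof.
move=> km AB eps0 low; rewrite -(energy_refine km).
rewrite [X in _ <= X](partition_big k xpredT) //= mulr_sumr.
apply: ler_sum => i _.
have sAi z : z \in A i -> k z == i by rewrite AB => /andP[].
apply: (@le_trans _ _ (\sum_(z in A i)
    (class_avg k' (k' z) - class_avg k (k z)) ^+ 2)); last first.
  rewrite [X in _ <= X](bigID (mem (A i))) /=.
  rewrite [X in _ <= X + _](eq_bigl (mem (A i))); last first.
    by move=> z /=; case zA: (z \in A i); rewrite ?andbF // sAi.
  by rewrite lerDl sumr_ge0 // => z _; rewrite sqr_ge0.
set F := fun z => class_avg k' (k' z) - class_avg k (k z).
have SF : \sum_(z in A i) F z =
    \sum_(z in A i) g z - class_avg k i * #|A i|%:R.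
  rewrite /F sumrB; congr (_ - _); last first.
    rewrite (eq_bigr (fun=> class_avg k i)) ?sumr_const ?mulr_natr //.
    by move=> z /sAi /eqP ->.
  have := sum_class_avg k' (fun j => ((j \in B i) && (m j == i))%:R).
  have E (G : Z -> R) : \sum_z ((k' z \in B i) && (m (k' z) == i))%:R * G z =
      \sum_(z in A i) G z.
    rewrite [RHS]big_mkcond; apply: eq_bigr => z _.
    by rewrite AB km; case: (_ && _); rewrite ?mul1r ?mul0r.
  by rewrite !E.
have := sqr_sum_le (A i) F; rewrite SF.
have [->|n0] := eqVneq (A i) set0; first by move=> _;
  rewrite big_set0 cards0 mulr0.
have A0 : 0 < #|A i|%:R :> R by rewrite ltr0n card_gt0.
have := low i; set a := #|A i|%:R in A0 *; set s := \sum_(z in A i) g z.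
set q := \sum_(z in A i) _; move=> l1 l2.
rewrite -(ler_pM2l A0); apply: le_trans l2.
have -> : a * (eps ^+ 2 * a) = (eps * a) ^+ 2 by ring.
have ea : 0 <= eps * a by rewrite mulr_ge0 // ltW.
have le : eps * a <= - (s - class_avg k i * a) by lra.
by rewrite -[X in _ <= X]sqrrN lerXn2r // nnegrE (le_trans ea).
Qed.

End ConditionalExpectation.

(** * Regularity lemma *)

Section Regularity.
Variables (R : realType).
Implicit Types (V C : finType).

Definition edge_ind V (e : rel V) (z : V * V) : R := (e z.1 z.2)%:R.

Definition wt V (e : rel V) (X Y : {set V}) : R :=
  \sum_(z in setX X Y) edge_ind e z.

Definition dens V (e : rel V) (X Y : {set V}) : R :=
  wt e X Y / (#|X|%:R * #|Y|%:R).

Definition fiber V C (c : V -> C) (i : C) : {set V} := [set v | c v == i].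

(** Only a deficit of density is witnessed: the embedding uses lower bounds on degrees, for which
    one-sided regularity is enough. *)
Definition sparse_witness V (e : rel V) (eps : R) (A B X Y : {set V}) :=
  [&& X \subset A, Y \subset B, eps * #|A|%:R <= #|X|%:R,
      eps * #|B|%:R <= #|Y|%:R
    & wt e X Y <= (dens e A B - eps) * (#|X|%:R * #|Y|%:R)].

Definition irregular V (e : rel V) (eps : R) (A B : {set V}) :=
  [exists p : {set V} * {set V}, sparse_witness e eps A B p.1 p.2].

Definition irregular_mass V C (e : rel V) (eps : R) (c : V -> C) : R :=
  \sum_(p : C * C | irregular e eps (fiber c p.1) (fiber c p.2))
     (#|fiber c p.1|%:R * #|fiber c p.2|%:R).

Definition pair_col V C (c : V -> C) (z : V * V) : C * C := (c z.1, c z.2).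

Lemma class_avg_pair V C (e : rel V) (c : V -> C) (p : C * C) :
  class_avg (edge_ind e) (pair_col c) p = dens e (fiber c p.1) (fiber c p.2).
Proof.
rewrite /class_avg /dens -natrM -cardsX; congr (_ / _%:R).
  by apply: eq_bigl => z; rewrite !inE /pair_col -pair_eqE.
by apply: eq_card => z; rewrite !inE /pair_col -pair_eqE.
Qed.

(** Each vertex adds to its colour, for every pair of clusters, its membership in the two sets of a
    witness. The rectangle of a witness fills at least [eps ^+ 2] of an irregular pair and has
    density lower by [eps], whence the power 4. *)
Lemma refine_irregular V C (e : rel V) (eps : R) (c : V -> C) : 0 <= eps ->
  exists c' : V -> C * {ffun C * C -> bool * bool},
    eps ^+ 4 * irregular_mass e eps c <=
      energy (edge_ind e) (pair_col c') - energy (edge_ind e) (pair_col c).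
Proof.
move=> eps0.
(* Regular pairs get empty sets, so that they contribute nothing to [energy_gain]. *)
pose W (q : C * C) : {set V} * {set V} :=
  odflt (set0, set0) [pick p : {set V} * {set V} |
     sparse_witness e eps (fiber c q.1) (fiber c q.2) p.1 p.2].
have WP q : if irregular e eps (fiber c q.1) (fiber c q.2)
    then sparse_witness e eps (fiber c q.1) (fiber c q.2) (W q).1 (W q).2
    else W q == (set0, set0).
  rewrite /W /irregular; case: pickP => [p Hp|no] /=.
    by case: existsP => // -[]; exists p.
  by case: existsP => // -[p]; rewrite no.
exists (fun v => (c v, [ffun q => (v \in (W q).1, v \in (W q).2)])).
set c' := fun v => _.
pose A q := setX (W q).1 (W q).2.
pose B q := [set r : (C * {ffun C * C -> bool * bool}) *
                     (C * {ffun C * C -> bool * bool}) |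
               (r.1.2 q).1 && (r.2.2 q).2].
have sW q : (W q).1 \subset fiber c q.1 /\ (W q).2 \subset fiber c q.2.
  have := WP q; by case: ifP => _ => [/and5P[]//|/eqP->]; rewrite !sub0set.
suff gain : eps ^+ 2 * \sum_q #|A q|%:R <=
    energy (edge_ind e) (pair_col c') - energy (edge_ind e) (pair_col c).
  apply: le_trans gain.
  rewrite (_ : eps ^+ 4 = eps ^+ 2 * eps ^+ 2); last by ring.
  rewrite -mulrA ler_wpM2l ?sqr_ge0 // mulr_sumr.
  rewrite [X in _ <= X](bigID
    (fun q : C * C => irregular e eps (fiber c q.1) (fiber c q.2))) /=.
  rewrite -[X in X <= _]addr0 lerD ?sumr_ge0 //.
  apply: ler_sum => q irr; have := WP q; rewrite irr => /and5P[_ _ h1 h2 _].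
  by rewrite cardsX natrM expr2 mulrACA ler_pM // mulr_ge0.
apply: (@energy_gain R _ (edge_ind e) _ _ (pair_col c) (pair_col c')
  (fun r => (r.1.1, r.2.1)) A B eps) => //.
- move=> q z; rewrite !inE /c' /= !ffunE /=.
  case: (boolP (z.1 \in _)) => //= z1; case: (boolP (z.2 \in _)) => //= z2.
  have [/subsetP s1 /subsetP s2] := sW q.
  have := s1 _ z1; have := s2 _ z2.
  by rewrite !inE /pair_col -pair_eqE /= => -> ->.
- move=> q; rewrite class_avg_pair; have := WP q.
  case: ifP => _ => [/and5P[_ _ _ _]|/eqP Wq].
    by rewrite /A cardsX natrM.
  have -> : A q = set0 by rewrite /A Wq; apply/setP => z; rewrite !inE.
  by rewrite big_set0 cards0 mulr0.
Qed.

Lemma edge_ind01 V (e : rel V) z : 0 <= edge_ind e z <= 1.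
Proof. by rewrite /edge_ind; case: (e _ _); rewrite ?lexx ?ler01. Qed.

(** [N] is the number of refinements still affordable: each one made at large irregular mass gains
    [eps ^+ 5 * #|V|%:R ^+ 2], and the energy never exceeds [#|V|%:R ^+ 2]. *)
Lemma regularity_iter (eps : R) (N M : nat) : 0 < eps ->
  exists M' : nat, forall V (e : rel V) C (c : V -> C), (#|C| <= M)%N ->
    #|V|%:R ^+ 2 * (1 - N%:R * eps ^+ 5)
      <= energy (edge_ind e) (pair_col c) ->
    exists (C' : finType) (c' : V -> C'), (#|C'| <= M')%N /\
      irregular_mass e eps c' <= eps * #|V|%:R ^+ 2.
Proof.
move=> eps0; elim: N M => [|N IH] M.
  exists M => V e C c cM; rewrite mul0r subr0 mulr1 => low.
  exists C, c; split=> //; have [c' gain] := refine_irregular e c (ltW eps0).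
  have := energy_le (pair_col c') (edge_ind01 e).
  rewrite card_prod natrM -expr2 => up.
  have m0 : eps ^+ 4 * irregular_mass e eps c <= 0 by lra.
  have : irregular_mass e eps c <= 0.
    by rewrite -(pmulr_rle0 _ (exprn_gt0 4 eps0)).
  by move/le_trans; apply; rewrite mulr_ge0 ?exprn_ge0 // ltW.
have [M' HM'] := IH (M * (2 * 2) ^ (M * M))%N.
exists (maxn M M') => V e C c cM low.
have [good|bad] := lerP (irregular_mass e eps c) (eps * #|V|%:R ^+ 2).
  by exists C, c; split=> //; rewrite leq_max cM.
have [c' gain] := refine_irregular e c (ltW eps0).
have [||C1 [c1 [cM1 g1]]] := HM' V e _ c'.
- rewrite card_prod card_ffun !card_prod card_bool.
  by rewrite leq_mul // leq_pexp2l // leq_mul.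
- apply: le_trans (_ : energy (edge_ind e) (pair_col c) +
    eps ^+ 4 * (eps * #|V|%:R ^+ 2) <= _).
    apply: le_trans (lerD low (lexx _)).
    rewrite -natr1; set a := #|V|%:R ^+ 2; set n : R := N%:R.
    by rewrite le_eqVlt; apply/orP; left; apply/eqP; ring.
  rewrite -lerBrDl; apply: le_trans gain.
  by rewrite ler_pM2l ?exprn_gt0 // ltW.
by exists C1, c1; split=> //; rewrite leq_max cM1 orbT.
Qed.

Lemma regularity (eps : R) : 0 < eps ->
  exists M : nat, forall V (e : rel V),
    exists (C : finType) (c : V -> C), (#|C| <= M)%N /\
      irregular_mass e eps c <= eps * #|V|%:R ^+ 2.
Proof.
move=> eps0.
(* For such [N] the energy required of the initial one-class partition is nonpositive. *)
have [N hN] : exists N : nat, 1 <= N%:R * eps ^+ 5.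
  exists (Num.truncn (eps ^+ 5)^-1).+1.
  have e5 : 0 < eps ^+ 5 by rewrite exprn_gt0.
  rewrite -ler_pdivrMr // mul1r ltW // truncnS_gt //.
have [M HM] := regularity_iter N 1 eps0; exists M => V e.
apply: (HM V e unit (fun=> tt)); first by rewrite card_unit.
apply: le_trans (energy_ge0 _ _).
by rewrite mulr_ge0_le0 ?exprn_ge0 // subr_le0.
Qed.

End Regularity.

(** * Reduced graph *)

Section ReducedGraph.
Variables (R : realType).
Implicit Types (V C I : finType).

Definition deg_in V (e : rel V) (Y : {set V}) (v : V) : nat :=
  #|[set y in Y | e v y]|.

Definition typical_pair V (e : rel V) (eps d : R) (A B : {set V}) :=
  forall Y : {set V}, Y \subset B -> eps * #|B|%:R <= #|Y|%:R ->
    #|[set x in A | (deg_in e Y x)%:R < d * #|Y|%:R]|%:R <= eps * #|A|%:R.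

Lemma wtE V (e : rel V) (X Y : {set V}) :
  wt R e X Y = \sum_(x in X) \sum_(y in Y) (e x y)%:R.
Proof.
by rewrite pair_big_dep /=; apply: eq_bigl => z; rewrite inE.
Qed.

Lemma wt_deg V (e : rel V) (X Y : {set V}) :
  wt R e X Y = \sum_(x in X) (deg_in e Y x)%:R.
Proof.
rewrite wtE; apply: eq_bigr => x _.
rewrite /deg_in -sum1_card natr_sum big_mkcond [RHS]big_mkcond /=.
apply: eq_bigr => y _; rewrite inE.
by case: (y \in Y) => //=; case: (e x y).
Qed.

(** The vertices of small degree into [Y] would form with [Y] a rectangle of density at most [d],
    hence a witness. *)
Lemma regular_typical V (e : rel V) (eps d : R) (A B : {set V}) :
  0 <= eps -> ~~ irregular e eps A B -> d + eps <= dens R e A B ->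
  typical_pair e eps d A B.
Proof.
move=> eps0 reg dd Y sY lY; rewrite leNgt; apply: contra reg => big.
set X := [set x in A | _] in big *.
apply/existsP; exists (X, Y); rewrite /sparse_witness /= sY lY (ltW big).
have -> /= : X \subset A by apply/subsetP => x; rewrite inE => /andP[].
rewrite wt_deg; apply: (@le_trans _ _ (\sum_(x in X) (d * #|Y|%:R))).
  by apply: ler_sum => x; rewrite inE => /andP[_ /ltW].
rewrite sumr_const -[X in X <= _]mulr_natr -mulrA [#|Y|%:R * _]mulrC.
by rewrite ler_wpM2r ?mulr_ge0 //; lra.
Qed.

Lemma wt_sym V (e : rel V) (A B : {set V}) : symmetric e ->
  wt R e A B = wt R e B A.
Proof.
move=> sym; rewrite !wtE exchange_big /=.
by apply: eq_bigr => x _; apply: eq_bigr => y _; rewrite sym.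
Qed.

Lemma dens_sym V (e : rel V) (A B : {set V}) : symmetric e ->
  dens R e A B = dens R e B A.
Proof. by move=> sym; rewrite /dens wt_sym // [_%:R * _]mulrC. Qed.

Lemma irregular_sym V (e : rel V) (eps : R) (A B : {set V}) : symmetric e ->
  irregular e eps A B = irregular e eps B A.
Proof.
move=> sym; apply/existsP/existsP => -[[X Y] /and5P[/= h1 h2 h3 h4 h5]];
  exists (Y, X); rewrite /sparse_witness /= h1 h2 h3 h4 /=;
  by rewrite wt_sym // dens_sym // [_%:R * _]mulrC.
Qed.

Lemma wt_le V (e : rel V) (A B : {set V}) : wt R e A B <= #|A|%:R * #|B|%:R.
Proof.
rewrite -natrM -cardsX -sum1_card natr_sum; apply: ler_sum => z _.
by case/andP: (edge_ind01 R e z).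
Qed.

Lemma wt_ge0 V (e : rel V) (A B : {set V}) : 0 <= wt R e A B.
Proof. by apply: sumr_ge0 => z _; case/andP: (edge_ind01 R e z). Qed.

(* S maximises the weight of the pairs inside minus K times the weight of the
   points, so no point of S can be deleted at a profit. *)
Lemma dense_subset I (w : I -> R) (m : I -> I -> R) (K : R) :
  (forall i j, m i j = m j i) -> (forall i j, 0 <= m i j) ->
  K * \sum_i w i < \sum_i \sum_j m i j ->
  exists S : {set I},
    (forall i, i \in S -> K * w i <= 2 * \sum_(j in S) m i j) /\
    (exists2 i, i \in S & K * w i < \sum_(j in S) m i j).
Proof.
move=> msym m0 tot.
pose F (S : {set I}) := \sum_(i in S) (\sum_(j in S) m i j - K * w i).
case: (@arg_maxP _ _ {set I} setT xpredT F) => // S _ maxS.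
exists S; split=> [i iS|].
  have := maxS (S :\ i) isT.
  (* A point [i] counts in its own row and in its column, whence the factor 2 in the conclusion. *)
  have -> : F S = (\sum_(j in S) m i j - K * w i) + \sum_(a in S :\ i) m i a +
      F (S :\ i).
    rewrite /F (big_setD1 i) //= -[RHS]addrA; congr (_ + _).
    rewrite -big_split /=.
    by apply: eq_bigr => a _; rewrite (big_setD1 i) //= msym addrA.
  rewrite (big_setD1 i (F := fun j => m i j)) //= => h.
  by have := m0 i i; lra.
have : 0 < F S.
  apply: lt_le_trans (maxS setT isT).
  rewrite /F sumrB -mulr_sumr subr_gt0 !(eq_bigl _ _ (in_setT (T := I))).
  by under [X in _ < X]eq_bigr do rewrite (eq_bigl _ _ (in_setT (T := I))).
move=> FS; apply/exists_inP; apply: contraLR FS; rewrite negb_exists_in.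
move/forall_inP => no; rewrite -leNgt; apply: sumr_le0 => i iS.
by rewrite subr_le0 leNgt no.
Qed.

Lemma sum_fiber V C (c : V -> C) : \sum_i #|fiber c i|%:R = #|V|%:R :> R.
Proof.
rewrite -natr_sum; congr _%:R; rewrite -sum1_card (partition_big c xpredT) //=.
by apply: eq_bigr => i _; rewrite -sum1_card; apply: eq_bigl => v; rewrite inE.
Qed.

End ReducedGraph.

(** * Cleaning the regular partition and finding a well-connected cluster *)

Section HostClusters.
Variables (R : realType).
Implicit Types (V C : finType).

Lemma sum_wt_fibers V C (e : rel V) (c : V -> C) :
  \sum_(p : C * C) wt R e (fiber c p.1) (fiber c p.2) =
    \sum_z edge_ind R e z.
Proof.
rewrite [RHS](partition_big (pair_col c) xpredT) //=.
apply: eq_bigr => p _; apply: eq_bigl => z.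
by rewrite !inE /pair_col -pair_eqE.
Qed.

Lemma sum_fiber_pairs V C (c : V -> C) (a : R) :
  \sum_(p : C * C) a * (#|fiber c p.1|%:R * #|fiber c p.2|%:R) =
    a * #|V|%:R ^+ 2.
Proof.
rewrite -mulr_sumr.
rewrite -(pair_bigA _ (fun i j => #|fiber c i|%:R * #|fiber c j|%:R)).
rewrite /=; under eq_bigr do rewrite -mulr_sumr sum_fiber.
by rewrite -mulr_suml sum_fiber expr2.
Qed.

Lemma sum_fiber_fst V C (c : V -> C) (a : R) :
  \sum_(p : C * C) a * #|fiber c p.1|%:R = #|C|%:R * (a * #|V|%:R).
Proof.
rewrite -(pair_bigA _ (fun i j => a * #|fiber c i|%:R)) /=.
rewrite (eq_bigr (fun i => #|C|%:R * (a * #|fiber c i|%:R))) => [|i _].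
  by rewrite -!mulr_sumr sum_fiber.
by rewrite sumr_const -[LHS]mulr_natl.
Qed.

Lemma sum_fiber_snd V C (c : V -> C) (a : R) :
  \sum_(p : C * C) a * #|fiber c p.2|%:R = #|C|%:R * (a * #|V|%:R).
Proof.
rewrite -(pair_bigA _ (fun i j => a * #|fiber c j|%:R)) exchange_big /=.
rewrite (eq_bigr (fun i => #|C|%:R * (a * #|fiber c i|%:R))) => [|i _].
  by rewrite -!mulr_sumr sum_fiber.
by rewrite sumr_const -[LHS]mulr_natl.
Qed.

(** Degrees in the reduced graph [r] are weighted by cluster sizes, so [K] is a number of vertices
    of the host graph. *)
Definition host V C (e : rel V) (eps d mu K : R) (c : V -> C) (r : rel C)
    (i0 : C) :=
  [/\ symmetric r,
      forall i j, r i j -> mu * #|V|%:R <= #|fiber c i|%:R,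
      forall i j, r i j -> typical_pair e eps d (fiber c i) (fiber c j),
      K <= \sum_(j | r i0 j) #|fiber c j|%:R
    & forall i, r i0 i -> K <= 2 * \sum_(j | r i j) #|fiber c j|%:R].

(** Irregular pairs, sparse pairs and small clusters each cost at most [eta / 8 * n ^+ 2] ordered
    pairs. The remaining surplus exceeds [eta / 2 * n ^+ 2], and [dense_subset], weighted by cluster
    sizes, turns it into degrees. *)
Lemma host_exists (eta eps d : R) : 0 < eta -> 0 < eps -> 0 < d ->
  eps <= eta / 8 -> d + eps <= eta / 8 ->
  exists (M : nat) (mu : R), 0 < mu /\ forall V (e : rel V) (k : R),
    symmetric e -> (0 < #|V|)%N -> 0 < k ->
    k * #|V|%:R + eta * #|V|%:R ^+ 2 <= \sum_z edge_ind R e z ->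
    exists (C : finType) (c : V -> C) (r : rel C) (i0 : C),
      (#|C| <= M)%N /\ host e eps d mu (k + eta / 2 * #|V|%:R) c r i0.
Proof.
move=> eta0 eps0 d0 epsle dle.
have [M HM] := regularity eps0.
have M0 : 0 <= M%:R :> R by [].
(* At most [M] clusters occur, so those below [mu * n] spoil at most [2 * M * mu * n ^+ 2] pairs;
   the added 1 keeps the denominator positive. *)
pose mu : R := eta / (16 * (M%:R + 1)).
have mu0 : 0 < mu by rewrite divr_gt0 // mulr_gt0 //; lra.
have muM : 2 * (M%:R * mu) <= eta / 8.
  have : mu * (16 * (M%:R + 1)) = eta by rewrite divfK // gt_eqF //; lra.
  by lra.
exists M, mu; split=> // V e k sym V0 k0 dense.
have [C [c [cM irr]]] := HM V e.
have n0 : 0 < #|V|%:R :> R by rewrite ltr0n.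
set n : R := #|V|%:R in dense irr n0 *.
pose f i : R := #|fiber c i|%:R.
pose r0 (i j : C) := [&& ~~ irregular e eps (fiber c i) (fiber c j),
  d + eps <= dens R e (fiber c i) (fiber c j), mu * n <= f i & mu * n <= f j].
have r0sym i j : r0 i j = r0 j i.
  by rewrite /r0 irregular_sym // dens_sym // [(mu * n <= f i) && _]andbC.
pose m i j : R := if r0 i j then wt R e (fiber c i) (fiber c j) else 0.
have msym i j : m i j = m j i by rewrite /m r0sym wt_sym.
have m0 i j : 0 <= m i j by rewrite /m; case: ifP => // _; exact: wt_ge0.
have f0 i : 0 <= f i by [].
have mle i j : m i j <= f i * f j.
  by rewrite /m; case: ifP => _; [exact: wt_le|rewrite mulr_ge0].
(* A pair of clusters either keeps its weight in [m] or is paid for by another term: irregular,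
   sparse, first cluster small, second cluster small. *)
have loss (p : C * C) : wt R e (fiber c p.1) (fiber c p.2) <=
   m p.1 p.2 + (if irregular e eps (fiber c p.1) (fiber c p.2)
                then f p.1 * f p.2 else 0)
   + (d + eps) * (f p.1 * f p.2) + mu * n * f p.1 + mu * n * f p.2.
  have up := wt_le R e (fiber c p.1) (fiber c p.2); rewrite -!/(f _) in up.
  have w0 := wt_ge0 R e (fiber c p.1) (fiber c p.2).
  have a1 : 0 <= f p.1 * f p.2 by rewrite mulr_ge0.
  have a2 : 0 <= (d + eps) * (f p.1 * f p.2) by rewrite mulr_ge0 //; lra.
  have a3 := mulr_ge0 (mulr_ge0 (ltW mu0) (ltW n0)) (f0 p.1).
  have a4 := mulr_ge0 (mulr_ge0 (ltW mu0) (ltW n0)) (f0 p.2).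
  rewrite /m /r0; case: (irregular _ _ _ _) => /=; first by lra.
  have [le1|gt1] /= := lerP (d + eps) _; last first.
    suff : wt R e (fiber c p.1) (fiber c p.2) <= (d + eps) * (f p.1 * f p.2).
      by lra.
    move: gt1 a1; rewrite /dens le_eqVlt => gt1 /orP[/eqP z|pos].
      by move: up; rewrite -z; lra.
    by rewrite -ler_pdivrMr // ltW.
  have [le2|gt2] /= := lerP (mu * n) (f p.1); last first.
    by have := ler_wpM2r (f0 p.2) (ltW gt2); lra.
  have [le3|gt3] /= := lerP (mu * n) (f p.2); last first.
    by have := ler_wpM2l (f0 p.1) (ltW gt3); lra.
  by lra.
have tot : (k + eta / 2 * n) * \sum_i f i < \sum_i \sum_j m i j.
  rewrite sum_fiber pair_bigA /= -/n.
  have := @ler_sum R _ (index_enum _) xpredT _ _ (fun p _ => loss p).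
  rewrite sum_wt_fibers !big_split /= sum_fiber_fst sum_fiber_snd.
  rewrite sum_fiber_pairs; set S := \sum_p m p.1 p.2.
  rewrite -big_mkcond -/n /= -/(irregular_mass e eps c) => h.
  have b1 : #|C|%:R * (mu * n * n) <= M%:R * mu * n ^+ 2.
    rewrite -mulrA -expr2 mulrA ler_wpM2r ?sqr_ge0 //.
    by rewrite ler_wpM2r ?(ltW mu0) // ler_nat.
  have n2 : 0 < n ^+ 2 by rewrite exprn_gt0.
  have b2 : (d + eps) * n ^+ 2 <= eta / 8 * n ^+ 2 by rewrite ler_wpM2r // ltW.
  have b3 : eps * n ^+ 2 <= eta / 8 * n ^+ 2 by rewrite ler_wpM2r // ltW.
  have b4 : 2 * (M%:R * mu) * n ^+ 2 <= eta / 8 * n ^+ 2.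
    by rewrite ler_wpM2r // ltW.
  have b5 : 0 < eta * n ^+ 2 by rewrite mulr_gt0.
  by rewrite mulrDl -mulrA -expr2; lra.
have [S [S1 [i0 i0S S2]]] := dense_subset msym m0 tot.
pose r i j := [&& r0 i j, i \in S & j \in S].
have K0 : 0 < k + eta / 2 * n.
  by rewrite addr_gt0 // mulr_gt0 // divr_gt0.
have mr i : i \in S -> \sum_(j in S) m i j <= f i * \sum_(j | r i j) f j.
  move=> iS; rewrite mulr_sumr [X in X <= _]big_mkcond [X in _ <= X]big_mkcond.
  apply: ler_sum => j _; rewrite /r iS /=; case: (j \in S); rewrite ?andbF //.
  by rewrite andbT; have := mle i j; rewrite /m; case: ifP.
exists C, c, r, i0; split=> //; split.
- by move=> i j; rewrite /r r0sym [(i \in S) && _]andbC.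
- by move=> i j /and3P[/and4P[]].
- move=> i j /and3P[/and4P[a1 a2 _ _] _ _].
  exact: regular_typical (ltW eps0) a1 a2.
- have := lt_le_trans S2 (mr _ i0S).
  (* Strictness in [S2] rules out an empty cluster [i0], so division by its size is allowed. *)
  have := f0 i0; rewrite le_eqVlt => /orP[/eqP <-|p].
    by rewrite mulr0 mul0r ltxx.
  by rewrite mulrC ltr_pM2l // => /ltW.
- move=> i /and3P[/and4P[_ _ _ fi] _ iS].
  have p : 0 < f i by apply: lt_le_trans fi; rewrite mulr_gt0.
  have := le_trans (S1 _ iS) (ler_wpM2l (ler0n R 2) (mr _ iS)).
  by rewrite mulrC mulrCA ler_pM2l.
Qed.

End HostClusters.

(** * Fractional assignment of cells *)

Section FractionalPlan.
Variables (R : realType) (C : finType) (r : rel C) (i0 : C) (cap : C -> R).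
Variables (a b : R).
Hypothesis cap_ge0 : forall v, 0 <= cap v.
Hypotheses (a_ge0 : 0 <= a) (b_ge0 : 0 <= b) (ab_gt0 : 0 < a + b).
Hypothesis a_le_b : a <= b.
Hypothesis cap_i0 : a + b <= \sum_(j | r i0 j) cap j.
Hypothesis cap_nbr :
  forall i, r i0 i -> a + b <= 2 * \sum_(j | r i j) cap j.

Definition cell_load (s : C * C) (v : C) : R :=
  b * (s.1 == v)%:R + a * (s.2 == v)%:R.

Lemma sum_pos_exists (P : pred C) : 0 < \sum_(j | P j) cap j ->
  exists j, P j.
Proof.
case: (pickP P) => [j Pj _|no]; first by exists j.
by rewrite big_pred0 // ltxx.
Qed.

(* Putting b on an e-minimal neighbour i of i0 and a on an e-minimal neighbour
   of i is dual feasible: the neighbours of i0 have capacity a + b, those of i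
   at least (a + b) / 2 >= a. *)
Lemma cheap_cell (e : C -> R) : (forall v, 0 <= e v) ->
  exists s : C * C, [/\ r i0 s.1, r s.1 s.2 &
    b * e s.1 + a * e s.2 <= \sum_v e v * cap v].
Proof.
move=> e0.
have [i1 ri1] := sum_pos_exists (lt_le_trans ab_gt0 cap_i0).
case: (@arg_minP _ _ C i1 (r i0) e ri1) => i ri mini.
have : 0 < \sum_(j | r i j) cap j by have := cap_nbr ri; have := ab_gt0; lra.
move=> /sum_pos_exists[j1 rj1].
case: (@arg_minP _ _ C j1 (r i) e rj1) => j rj minj.
exists (i, j); split=> //=.
set al := e i; set be := e j.
have al0 : 0 <= al := e0 i; have be0 : 0 <= be := e0 j.
(* If [j] is no dearer than [i], the neighbours of [i0] pay the price [al] for all of [a + b].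
   Otherwise the extra [be - al] on [a], which is at most half of [a + b], is paid by the neighbours
   of [i]. *)
have [le|lt] := lerP be al.
  apply: (@le_trans _ _ (al * (a + b))).
    by have := ler_wpM2l a_ge0 le; lra.
  apply: le_trans (ler_wpM2l al0 cap_i0) _.
  rewrite mulr_sumr [X in X <= _]big_mkcond; apply: ler_sum => v _.
  case: ifP => [rv|_]; last by rewrite mulr_ge0.
  by rewrite ler_wpM2r // mini.
apply: (@le_trans _ _ (al * (a + b) + (be - al) * ((a + b) / 2))).
  have : 0 <= (be - al) * (b - a) by rewrite mulr_ge0 ?subr_ge0 // ltW.
  by lra.
have h2 : (a + b) / 2 <= \sum_(j | r i j) cap j by have := cap_nbr ri; lra.
have d0 : 0 <= be - al by rewrite subr_ge0 ltW.
apply: le_trans (lerD (ler_wpM2l al0 cap_i0) (ler_wpM2l d0 h2)) _.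
rewrite !mulr_sumr big_mkcond [X in _ + X <= _]big_mkcond -big_split /=.
apply: ler_sum => v _; have c0 := cap_ge0 v.
have p1 : r i0 v -> al * cap v <= e v * cap v.
  by move=> rv; rewrite ler_wpM2r // mini.
have p2 : r i v -> be * cap v <= e v * cap v.
  by move=> rv; rewrite ler_wpM2r // minj.
have p3 : 0 <= e v * cap v by rewrite mulr_ge0.
have p4 : 0 <= al * cap v by rewrite mulr_ge0.
case: (r i0 v) p1 => p1; case: (r i v) p2 => p2; rewrite ?add0r ?addr0 //.
- by have := p2 isT; lra.
- exact: p1.
- by have := p2 isT; lra.
Qed.

Variable N : R.
Hypotheses (cap_le : forall v, cap v <= N) (ab_le : a + b <= N).

(** The accumulated excesses [e] act as prices for the next cell. A cheap cell makes the linear term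
    in the change of the sum of squares nonpositive, so this sum grows linearly in [n] and each
    excess only like the square root of [n]. *)
Lemma online_plan (n : nat) : exists (s : nat -> C * C) (e : C -> R),
  [/\ forall t, r i0 (s t).1 && r (s t).1 (s t).2, forall v, 0 <= e v,
      forall v, \sum_(t < n) cell_load (s t) v <= n%:R * cap v + e v
    & \sum_v e v ^+ 2 <= n%:R * (#|C|%:R * N ^+ 2)].
Proof.
elim: n => [|n [s [e [sP e0 load pot]]]].
  have [s [s1 s2 _]] := cheap_cell (fun=> lexx 0).
  exists (fun=> s), (fun=> 0); split=> // [t|v|]; first by rewrite s1.
    by rewrite big_ord0 mul0r addr0.
  by rewrite mul0r big1 // => v _; rewrite expr0n.
have [c [c1 c2 cheap]] := cheap_cell e0.
pose dlt v := cell_load c v - cap v.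
exists (fun t => if t == n then c else s t), (fun v => Num.max 0 (e v + dlt v)).
split.
- by move=> t; case: eqP => _ //; rewrite c1.
- by move=> v; rewrite le_max lexx.
- move=> v; rewrite big_ord_recr /= eqxx.
  rewrite (eq_bigr (fun t : 'I_n => cell_load (s t) v)) => [|t _]; last first.
    by rewrite ltn_eqF.
  have := load v; set l := \sum_(t < n) _; rewrite -natr1 => lv.
  have : e v + dlt v <= Num.max 0 (e v + dlt v) by rewrite le_max lexx orbT.
  by rewrite /dlt; lra.
have dl v : dlt v ^+ 2 <= N ^+ 2.
  have : - N <= dlt v <= N.
    have := cap_ge0 v; have := cap_le v; rewrite /dlt /cell_load.
    have := ab_le; have := a_ge0; have := b_ge0.
    by case: (_ == v); case: (_ == v) => /= *; apply/andP; split; lra.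
  move=> /andP[l1 l2]; have : 0 <= (N - dlt v) * (N + dlt v).
    by rewrite mulr_ge0; lra.
  by lra.
apply: (@le_trans _ _ (\sum_v (e v ^+ 2 + 2 * (e v * dlt v) + N ^+ 2))).
  apply: ler_sum => v _; apply: (@le_trans _ _ ((e v + dlt v) ^+ 2)).
    by rewrite /Num.max; case: ifP => // _; rewrite expr0n /= sqr_ge0.
  by have := dl v; lra.
rewrite !big_split /= -mulr_sumr sumr_const -[_ ^+ 2 *+ _]mulr_natl -natr1.
suff : \sum_v e v * dlt v <= 0 by lra.
have -> : \sum_v e v * dlt v =
    b * e c.1 + a * e c.2 - \sum_v e v * cap v.
  rewrite /dlt /cell_load; under eq_bigr do rewrite mulrBr.
  rewrite sumrB; congr (_ - _).
  under eq_bigr do rewrite mulrDr.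
  have pick w x : \sum_v e v * (x * (w == v)%:R) = x * e w.
    rewrite (bigD1 w) //= eqxx big1 => [|v]; first by rewrite /=; ring.
    by rewrite eq_sym => /negPf -> /=; ring.
  by rewrite big_split /= !pick.
by lra.
Qed.

Lemma fractional_plan (xi : R) : 0 < xi ->
  exists (n : nat) (s : 'I_n -> C * C), [/\ (0 < n)%N,
    forall t, r i0 (s t).1 && r (s t).1 (s t).2 &
    forall v, b * #|[set t | (s t).1 == v]|%:R +
              a * #|[set t | (s t).2 == v]|%:R <= n%:R * (cap v + xi)].
Proof.
move=> xi0; pose B := #|C|%:R * N ^+ 2.
have B0 : 0 <= B by rewrite mulr_ge0 // sqr_ge0.
(* This makes [B] at most [n * xi ^+ 2], so that the square root of [n * B] is at most [n * xi]. *)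
pose n := (Num.truncn (B / xi ^+ 2)).+1.
have [s [e [sP e0 load pot]]] := online_plan n.
exists n, (fun t : 'I_n => s t); split=> // v.
have -> : b * #|[set t : 'I_n | (s t).1 == v]|%:R +
   a * #|[set t : 'I_n | (s t).2 == v]|%:R = \sum_(t < n) cell_load (s t) v.
  rewrite big_split /= -!mulr_sumr -!sum1_card !natr_sum.
  congr (_ * _ + _ * _); rewrite big_mkcond; apply: eq_bigr => t _;
    by rewrite inE; case: (_ == v).
apply: le_trans (load v) _; rewrite mulrDr lerD2l.
have n0 : 0 < n%:R :> R by rewrite ltr0n.
have Bn : B <= n%:R * xi ^+ 2.
  rewrite -ler_pdivrMr ?exprn_gt0 // ltW // truncnS_gt //.
rewrite -(@ler_pXn2r _ 2) ?nnegrE ?mulr_ge0 // ?(ltW xi0) //.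
apply: (@le_trans _ _ (n%:R * B)).
  apply: le_trans pot; rewrite (bigD1 v) //= lerDl sumr_ge0 // => w _.
  exact: sqr_ge0.
rewrite exprMn expr2 -mulrA; apply: ler_wpM2l Bn; exact: ltW.
Qed.

End FractionalPlan.

(** * Rooting and cutting a tree *)

Definition rooted (T : finType) (r : T) (p : T -> T) (dist : T -> nat) :=
  [/\ p r = r, dist r = 0%N &
      forall x, x != r -> dist x = (dist (p x)).+1].

Section Rooting.
Variables (G : sgraph) (r : G).
Hypothesis conn : forall x y : G, connect (@adj G) x y.

Definition ball n : {set G} :=
  iter n (fun S => S :|: [set y | [exists x in S, adj x y]]) [set r].

Lemma ball_adj n x y : x \in ball n -> adj x y -> y \in ball n.+1.
Proof.
move=> xn xy; rewrite /ball iterS inE; apply/orP; right.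
by rewrite inE; apply/exists_inP; exists x.
Qed.

Lemma ball_exists x : exists n, x \in ball n.
Proof.
have /connectP[s ps ->] := conn r x.
suff H n y : y \in ball n -> path (@adj G) y s ->
    last y s \in ball (n + size s).
  by exists (0 + size s)%N; apply: H => //; rewrite inE.
elim: s n y {ps} => [|z s IH] n y yn /=; first by rewrite addn0.
by case/andP=> yz zs; rewrite addnS -addSn; apply: IH zs; apply: ball_adj yz.
Qed.

Definition root_dist x := ex_minn (ball_exists x).

Definition parent x :=
  odflt r [pick y | adj x y && (root_dist y < root_dist x)%N].

Lemma root_dist_ball x : x \in ball (root_dist x).
Proof. by rewrite /root_dist; case: ex_minnP. Qed.

Lemma root_dist_le x n : x \in ball n -> (root_dist x <= n)%N.
Proof. by rewrite /root_dist; case: ex_minnP => m _; apply. Qed.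

Lemma root_dist_root : root_dist r = 0%N.
Proof. by apply/eqP; rewrite -leqn0 root_dist_le // inE. Qed.

Lemma parentP x : x != r ->
  adj x (parent x) /\ root_dist x = (root_dist (parent x)).+1.
Proof.
move=> xr; rewrite /parent; case: pickP => [y /andP[xy lt]|no] /=.
  split=> //; apply/eqP; rewrite eqn_leq lt andbT root_dist_le //.
  by apply: (ball_adj (root_dist_ball y)); rewrite adj_sym.
exfalso; have := root_dist_ball x; case E: (root_dist x) => [|m].
  by rewrite inE (negPf xr).
rewrite /ball iterS inE => /orP[/root_dist_le|]; first by rewrite E ltnn.
rewrite inE => /exists_inP[y ym yx]; have := no y.
by rewrite adj_sym yx E ltnS root_dist_le.
Qed.

Lemma parent_root : parent r = r.
Proof.
by rewrite /parent; case: pickP => // y; rewrite root_dist_root ltn0 andbF.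
Qed.

Lemma rooted_parent : rooted r parent root_dist.
Proof.
split; [exact: parent_root|exact: root_dist_root|].
by move=> x /parentP[].
Qed.

Definition tree_edge x y := adj x y && ((parent x == y) || (parent y == x)).

Lemma tree_edge_connect x y : connect tree_edge x y.
Proof.
have sym : symmetric tree_edge.
  by move=> a b; rewrite /tree_edge adj_sym orbC.
suff H a : connect tree_edge a r.
  by apply: connect_trans (H x) _; rewrite (sym_connect_sym sym) H.
elim: {a}(root_dist a) {-2}a (erefl (root_dist a)) => [|n IH] a da.
  have [->|ar] := eqVneq a r; first exact: connect0.
  by have [_] := parentP ar; rewrite da.
have [->|ar] := eqVneq a r; first exact: connect0.
have [ap dp] := parentP ar.
apply: connect_trans (IH (parent a) _); last by move: dp; rewrite da => -[].
by apply: connect1; rewrite /tree_edge ap eqxx.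
Qed.

(* An edge outside the parent relation would close a cycle with the parent
   path joining its ends. *)
Lemma acyclic_parent : acyclic_graph G ->
  forall x y : G, adj x y -> parent x = y \/ parent y = x.
Proof.
move=> acyc x y xy.
suff : tree_edge x y by case/andP=> _ /orP[] /eqP; [left|right].
apply/negPn/negP => nt.
have /connectP[s0 ps0 lasty] := tree_edge_connect x y.
case/shortenP: ps0 lasty => s ps us _ lasty.
have s2 : (1 < size s)%N.
  case: s ps lasty {us} => [|z [|w s]] //=.
    by move=> _ E; move: xy; rewrite E adj_irrefl.
  by move=> /andP[xz _] E; move: nt; rewrite E xz.
suff /acyc /= : ucycle (@adj G) (x :: s) by rewrite ltnS ltnNge s2.
rewrite /ucycle us andbT /= rcons_path -lasty adj_sym xy andbT.
by apply: sub_path ps => a b /andP[].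
Qed.

End Rooting.

(** The parity of the distance to an arbitrary vertex two-colours the tree; [col] is the class that
    is not larger, and the tree is rooted anew inside it. Having two vertices ensures that both
    parities occur. *)
Lemma tree_rooting (G : sgraph) : is_tree G -> (1 < #|G|)%N ->
  exists (r : G) (p : G -> G) (dist : G -> nat) (col : pred G),
  [/\ rooted r p dist, (forall x y : G, adj x y -> p x = y \/ p y = x),
      (forall x, x != r -> adj x (p x)),
      col r /\ (forall x, x != r -> col (p x) = ~~ col x)
    & (#|[set x | col x]| <= #|[set x | ~~ col x]|)%N].
Proof.
move=> [[_ conn] acyc] G1.
have [r0 _] : exists r0 : G, r0 \in G by apply/card_gt0P; apply: ltnW.
have col_adj (x y : G) : adj x y ->
    odd (root_dist r0 conn x) = ~~ odd (root_dist r0 conn y).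
  move=> xy; have [E|E] := acyclic_parent r0 conn acyc xy.
    have [xr|xr] := eqVneq x r0.
      by move: xy; rewrite -E xr parent_root adj_irrefl.
    by have [_] := parentP conn xr; rewrite E => ->.
  have [yr|yr] := eqVneq y r0.
    by move: xy; rewrite -E yr parent_root adj_irrefl.
  by have [_] := parentP conn yr; rewrite E => -> /=; rewrite negbK.
pose c0 := fun x => odd (root_dist r0 conn x).
have c0adj x y : adj x y -> c0 x = ~~ c0 y by exact: col_adj.
have [x1 xr1] : exists x1, x1 != r0.
  apply/existsP; rewrite -negb_forall; apply/negP => /forallP all0.
  move: G1; rewrite ltnNge => /negP; apply; apply/card_le1_eqP => x y _ _.
  by rewrite (eqP (all0 x)) (eqP (all0 y)).
have [xp _] := parentP conn xr1.
pose col := fun x => c0 x == (#|[set x | c0 x]| <= #|[set x | ~~ c0 x]|)%N.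
have [r cr] : exists r, col r.
  rewrite /col; have := c0adj _ _ xp; case: (_ <= _)%N; case E: (c0 x1) => E2.
  - by exists x1; rewrite E.
  - by exists (parent r0 conn x1); case: (c0 _) E2.
  - by exists (parent r0 conn x1); case: (c0 _) E2.
  - by exists x1; rewrite E.
exists r, (parent r conn), (root_dist r conn), col; split.
- exact: rooted_parent.
- exact: acyclic_parent.
- by move=> x /(parentP conn)[].
- split=> // x /(parentP conn)[/c0adj xx _].
  by rewrite /col xx; case: (c0 _); case: (_ <= _)%N.
- rewrite /col; case: (leqP #|[set x | c0 x]|) => [|/ltnW] le;
    apply: leq_trans (leq_trans _ le) _;
    by apply: subset_leq_card; apply/subsetP => x; rewrite !inE; case: (c0 x).
Qed.

(** * Cutting a rooted tree into few seeds and small blocks *)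

Section Cutting.
Variables (T : finType) (r : T) (p : T -> T) (dist : T -> nat).
Hypothesis root : rooted r p dist.

Definition climb_edge (W : {set T}) : rel T :=
  [rel y z | (y \notin W) && (z == p y)].

(* The vertices below t that reach t without passing through W on the way. *)
Definition subtree (W : {set T}) (t : T) : {set T} :=
  [set y | connect (climb_edge W) y t].

Lemma dist_parent x : x = r \/ dist x = (dist (p x)).+1.
Proof. by case: root => _ _ H; case: (eqVneq x r) => [|/H]; [left|right]. Qed.

Lemma climb_dist (W : {set T}) y t :
  connect (climb_edge W) y t -> y = t \/ (dist t < dist y)%N.
Proof.
case/connectP=> s; elim: s y => [|z s IH] y /=; first by left.
case/andP=> /andP[_ /eqP ->] ps lt.
have pr : p r = r by case: root.
case: (dist_parent y) => [yr|dy].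
  by move: ps lt; rewrite yr pr => ps lt; apply: IH ps lt.
by right; rewrite dy ltnS; case: (IH _ ps lt) => [<-|/ltnW].
Qed.

(** Climbing is deterministic and stops at the first element of [W]. *)
Lemma climb_unique (W : {set T}) y x x' : x \in W -> x' \in W ->
  connect (climb_edge W) y x -> connect (climb_edge W) y x' -> x = x'.
Proof.
move=> xW xW' /connectP[s]; elim: s y => [|z s IH] y /=.
  move=> _ xy; rewrite xy in xW *.
  case/connectP=> -[|z s] /=; first by move=> _ ->.
  by rewrite {1}/climb_edge /= xW.
case/andP=> /andP[yW /eqP ->] ps lx.
case/connectP=> -[|z' s'] /=; first by move=> _ E; rewrite -E xW' in yW.
case/andP=> /andP[_ /eqP ->] ps' lx'.
by apply: IH ps lx _; apply/connectP; exists s'.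
Qed.

Lemma disjoint_subtrees (W : {set T}) (s : nat) :
  (forall x, x \in W -> s <= #|subtree W x|)%N -> (s * #|W| <= #|T|)%N.
Proof.
move=> big; rewrite mulnC -sum_nat_const.
apply: (@leq_trans (\sum_(x in W) #|subtree W x|)%N); first exact: leq_sum.
have -> : (\sum_(x in W) #|subtree W x| =
  \sum_y \sum_(x in W) (y \in subtree W x))%N.
  rewrite exchange_big /=; apply: eq_bigr => x _.
  by rewrite -sum1_card big_mkcond; apply: eq_bigr => y _; case: (_ \in _).
rewrite -sum1_card; apply: leq_sum => y _.
rewrite -big_mkcondr /= sum1_card; apply/card_le1_eqP => x x'.
case/andP=> xW; rewrite inE => yx /andP[xW']; rewrite inE => yx'.
exact: climb_unique yx' yx.
Qed.

(* Levels are treated from the deepest one upwards: a vertex joins W as soon as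
   the vertices hanging below it and not yet cut off number at least s. *)
Lemma cut_level (s m D : nat) : (forall x, dist x < D + m)%N ->
  exists W : {set T}, [/\ forall x, x \in W -> (s <= #|subtree W x|)%N,
    forall x, x \in W -> (D <= dist x)%N &
    forall t, (D <= dist t)%N -> t \notin W -> (#|subtree W t| < s)%N].
Proof.
elim: m D => [|m IH] D dD.
  exists set0; split=> [x|x|t Dt]; rewrite ?inE //.
  by have := dD t; rewrite addn0 ltnNge Dt.
have [|W [W1 W2 W3]] := IH D.+1; first by move=> x; rewrite addSnnS.
pose N := [set x | (dist x == D) && (s <= #|subtree W x|)%N].
(* A climb ending at level [D] or deeper can meet level [D] only at its end, so cutting at that
   level changes no such subtree. *)
have same t : (D <= dist t)%N -> subtree (W :|: N) t = subtree W t.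
  move=> Dt; apply/setP => y; rewrite !inE; apply/idP/idP.
    apply: connect_sub => a b /andP[aW /eqP ->]; apply: connect1.
    by rewrite /climb_edge /= eqxx andbT; apply: contra aW; rewrite inE => ->.
  case/connectP=> q; elim: q y => [|z q IHq] y /=; first by move=> _ ->.
  case/andP=> /andP[yW zy] pq lt.
  have [->|yt] := eqVneq y t; first exact: connect0.
  apply: connect_trans (connect1 _) (IHq z pq lt).
  rewrite /climb_edge /= zy andbT !inE (negPf yW) /=.
  apply: contra yt => /andP[/eqP yD _].
  have : connect (climb_edge W) y t.
    by apply/connectP; exists (z :: q); rewrite //= {1}/climb_edge /= yW zy.
  by case/climb_dist => [->//|]; rewrite yD ltnNge Dt.
exists (W :|: N); split=> [x|x|t Dt].
- rewrite inE => /orP[xW|]; first by rewrite same ?W1 // ltnW // W2.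
  by rewrite inE => /andP[/eqP xD xs]; rewrite same // xD.
- by rewrite inE => /orP[/W2/ltnW//|]; rewrite inE => /andP[/eqP ->].
rewrite same // !inE negb_or => /andP[tW]; rewrite negb_and -ltnNge.
case/orP=> // tD; apply: W3 => //.
by rewrite ltn_neqAle eq_sym tD.
Qed.

(** Each seed is a block by itself; the other blocks are the components left after deleting the
    seeds, and their tops are children of seeds. *)
Definition is_top (W : {set T}) x := (x \in W) || (p x \in W).

Fixpoint climb_iter (W : {set T}) n x :=
  if is_top W x then x else if n is m.+1 then climb_iter W m (p x) else x.

Definition top (W : {set T}) x := climb_iter W (dist x) x.

Section Tops.
Variable W : {set T}.
Hypothesis rW : r \in W.

Lemma is_topPn x : ~~ is_top W x -> dist x = (dist (p x)).+1.
Proof.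
by case: (dist_parent x) => // ->; rewrite /is_top rW.
Qed.

Lemma topE x : top W x = if is_top W x then x else top W (p x).
Proof.
case: ifPn => [t|nt].
  by rewrite /top; case: (dist x) => [|n] /=; rewrite t.
by rewrite /top (is_topPn nt) /= (negPf nt).
Qed.

Lemma top_connect x : connect (climb_edge W) x (top W x).
Proof.
elim: {x}(dist x) {-2}x (erefl (dist x)) => [|n IH] x dx; rewrite topE;
  case: ifPn => [_|nt]; rewrite ?connect0 //; have := is_topPn nt;
  rewrite dx // => -[/esym d].
apply: connect_trans (IH _ d); apply: connect1.
rewrite /climb_edge /= eqxx andbT.
by apply: contra nt; rewrite /is_top => ->.
Qed.

Lemma top_seed x : top W x \in W -> top W x = x.
Proof.
elim: {x}(dist x) {-2}x (erefl (dist x)) => [|n IH] x dx; rewrite topE;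
  case: ifPn => [_|nt] //; have := is_topPn nt; rewrite dx // => -[/esym d] tW.
have pW : p x \in W by rewrite -(IH _ d tW).
by move: nt; rewrite /is_top pW orbT.
Qed.

End Tops.

Variable col : pred T.
Hypotheses (col_r : col r) (col_p : forall x, x != r -> col (p x) = ~~ col x).

(** The root and the parents of the seeds outside [col] join the cutting set [W0]. These parents lie
    in [col], so one round suffices and [W] at most doubles, up to the root. Disjointness of the
    subtrees bounds [W0], and the degree bound then bounds the tops. *)
Lemma cut_tree (s D : nat) : (0 < s)%N ->
  (forall x, #|[set y | (y != r) && (p y == x)]| <= D)%N ->
  exists W : {set T}, [/\ r \in W,
    forall x, x \in W -> ~~ col x -> p x \in W,
    forall t, (#|[set x | top W x == t]| <= s)%N &
    (#|[set x | is_top W x]| * s <= (2 * #|T| + s) * D.+1)%N].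
Proof.
move=> s0 degD.
have [|W0 [W1 _ W3]] := @cut_level s (\max_x dist x).+1 0.
  by move=> x; rewrite add0n ltnS leq_bigmax.
pose W := r |: (W0 :|: [set p x | x in W0 & ~~ col x]).
have rW : r \in W by rewrite !inE eqxx.
have sW : W0 \subset W by apply/subsetP => x xW; rewrite !inE xW orbT.
have cW : (#|W| <= 2 * #|W0| + 1)%N.
  rewrite cardsU1 addnC leq_add ?leq_b1 // mul2n -addnn.
  apply: leq_trans (leq_card_setU _ _) _; rewrite leq_add2l.
  apply: leq_trans (leq_imset_card _ _) _; apply: subset_leq_card.
  by apply/subsetP => x; rewrite inE => /andP[].
have pr : p r = r by case: root.
exists W; split=> //.
- move=> x; rewrite !inE => /or3P[/eqP -> |xW|/imsetP[y]].
  + by rewrite col_r.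
  + move=> cx; apply/or3P; apply: Or33; apply/imsetP; exists x => //.
    by rewrite inE xW.
  + rewrite inE => /andP[_ cy] ->; have [->|yr] := eqVneq y r.
      by rewrite pr col_r.
    by rewrite col_p // cy.
- move=> t; have [tW|tW] := boolP (t \in W).
    apply: leq_trans s0; apply/card_le1_eqP => x y; rewrite !inE.
    move=> /eqP xt /eqP yt; rewrite -(top_seed rW (x := x)) ?xt //.
    by rewrite -(top_seed rW (x := y)) ?yt.
  have tW0 : t \notin W0 by apply: contra tW; apply: (subsetP sW).
  apply: leq_trans (ltnW (W3 t isT tW0)); apply: subset_leq_card.
  apply/subsetP => x; rewrite !inE => /eqP <-.
  apply: connect_sub (top_connect rW x) => a b /andP[aW /eqP ->].
  apply: connect1; rewrite /climb_edge /= eqxx andbT; apply: contra aW.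
  exact: (subsetP sW).
have tops : (#|[set x | is_top W x]| <= #|W| * D.+1)%N.
  pose below w := [set y | (y != r) && (p y == w)].
  apply: (@leq_trans #|W :|: \bigcup_(w in W) below w|).
    apply: subset_leq_card; apply/subsetP => x; rewrite inE in_setU /is_top.
    case/orP => [->//|pW]; apply/orP; have [->|xr] := eqVneq x r; first by left.
    by right; apply/bigcupP; exists (p x) => //; rewrite inE xr eqxx.
  apply: leq_trans (leq_card_setU _ _) _; rewrite mulnS leq_add2l.
  have : (forall A : {set T}, #|\bigcup_(w in A) below w|
     <= \sum_(w in A) #|below w|)%N.
    move=> A; elim/big_rec2: _ => [|i a B _ h]; first by rewrite cards0.
    by apply: leq_trans (leq_card_setU _ _) _; rewrite leq_add2l.
  move=> /(_ W) /leq_trans; apply; rewrite -sum_nat_const.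
  by apply: leq_sum => w _; exact: degD.
apply: leq_trans (leq_mul tops (leqnn s)) _.
rewrite mulnAC leq_mul2r; apply/orP; right.
apply: leq_trans (leq_mul cW (leqnn s)) _.
rewrite mulnDl mul1n leq_add2r -mulnA leq_mul2l /= mulnC.
exact: disjoint_subtrees.
Qed.

End Cutting.

(** * Embedding one block *)

Section GreedyBlock.
Variables (T V : finType) (e : rel V) (p : T -> T) (dist : T -> nat).
Variables (X : {set T}) (t : T) (H : T -> {set V}) (v0 : V).
Hypothesis tX : t \in X.
Hypothesis pX : forall x, x \in X -> x != t ->
  p x \in X /\ (dist (p x) < dist x)%N.
Hypothesis ext : forall x v, x \in X -> x != t -> v \in H (p x) ->
  (#|X| <= #|[set u in H x | e v u]|)%N.

(** An unplaced vertex of least [dist] has its parent placed. Fewer than [#|X|] images are taken,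
    while the image of the parent has at least [#|X|] neighbours among the candidates. *)
Lemma greedy_block : v0 \in H t -> exists g : T -> V,
  [/\ g t = v0, {in X &, injective g}, forall x, x \in X -> g x \in H x &
      forall x, x \in X -> x != t -> e (g (p x)) (g x)].
Proof.
move=> v0H.
suff main n : exists (Y : {set T}) (g : T -> V),
  [/\ t \in Y, Y \subset X & forall x, x \in Y -> x != t -> p x \in Y] /\
  [/\ g t = v0, {in Y &, injective g}, forall x, x \in Y -> g x \in H x &
      forall x, x \in Y -> x != t -> e (g (p x)) (g x)] /\
  ((X \subset Y) || (n <= #|Y|)%N).
  have [Y [g [[tY sY _] [[gt inj gH ge] big]]]] := main #|X|.+1.
  have sX : X \subset Y.
    by case/orP: big => //; rewrite ltnNge subset_leq_card.
  have E : X = Y by apply/eqP; rewrite eqEsubset sX.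
  by rewrite E; exists g.
elim: n => [|n [Y [g [[tY sY clY] [[gt inj gH ge] big]]]]].
  exists [set t], (fun=> v0); split; first split.
  - by rewrite inE.
  - by rewrite sub1set.
  - by move=> x; rewrite inE => ->.
  split; last by rewrite orbT.
  split=> // x; rewrite ?inE; first by move=> y /eqP -> /set1P ->.
    by move/eqP ->.
  by move=> ->.
have [sXY|nXY] := boolP (X \subset Y); first by exists Y, g; rewrite sXY.
have {}big : (n <= #|Y|)%N by rewrite (negPf nXY) in big.
have [x1 x1X x1Y] : exists2 x, x \in X & x \notin Y by apply/subsetPn.
pose P x := (x \in X) && (x \notin Y).
case: (@arg_minnP _ x1 P dist) => [|x /andP[xX xY] minx].
  by rewrite /P x1X.
have xt : x != t by apply: contraNneq xY => ->.
have [pxX dx] := pX xX xt.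
have pxY : p x \in Y.
  by apply: contraLR dx => npx; rewrite -leqNgt minx // /P pxX.
have lt : (#|g @: Y| < #|[set u in H x | e (g (p x)) u]|)%N.
  apply: leq_trans (ext xX xt (gH _ pxY)).
  apply: leq_ltn_trans (leq_imset_card _ _) _.
  apply: proper_card; rewrite properE sY; by apply/subsetPn; exists x.
have /subsetPn[u] : ~~ ([set u in H x | e (g (p x)) u] \subset g @: Y).
  by apply: contraL lt => /subset_leq_card; rewrite -leqNgt.
rewrite inE => /andP[uH eu] unew.
have gne y : y \in Y -> (y == x) = false.
  by move=> yY; apply: contraNF xY => /eqP <-.
have gu y : y \in Y -> g y != u.
  by move=> yY; apply: contraNneq unew => <-; rewrite imset_f.
exists (x |: Y), (fun y => if y == x then u else g y); split; first split.
- by rewrite !inE tY orbT.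
- by rewrite subUset sub1set xX.
- move=> y; rewrite !inE => /orP[/eqP -> _|yY yt]; first by rewrite pxY orbT.
  by rewrite clY // orbT.
split; last by rewrite cardsU1 xY add1n ltnS big orbT.
split.
- by rewrite gne.
- move=> y z; rewrite !inE => /orP[/eqP ->|yY] /orP[/eqP ->|zY] //=;
    rewrite ?eqxx ?gne //.
  + by move=> E; have := gu z zY; rewrite -E eqxx.
  + by move=> E; have := gu y yY; rewrite E eqxx.
  + exact: inj.
- by move=> y; rewrite !inE => /orP[/eqP ->|yY]; rewrite ?eqxx ?gne // gH.
- move=> y; rewrite !inE => /orP[/eqP -> _|yY yt]; first by rewrite eqxx gne.
  by rewrite gne ?clY // gne // ge.
Qed.

End GreedyBlock.

(** * Online choice of the cell of one block *)

Section CellChoice.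
Variables (R : realType) (C : finType) (N : nat) (s : 'I_N -> C * C).
Variable theta : R.
Hypotheses (N0 : (0 < N)%N) (theta_ge0 : 0 <= theta) (theta_le : theta <= 2^-1).

Definition count1 v : R := #|[set t | (s t).1 == v]|%:R.
Definition count2 v : R := #|[set t | (s t).2 == v]|%:R.

Lemma exists_le0 (I : finType) (A : {set I}) (F : I -> R) :
  A != set0 -> \sum_(i in A) F i <= 0 -> exists2 i, i \in A & F i <= 0.
Proof.
case/set0Pn => i iA le; apply/exists_inP; apply: contraLR le.
rewrite negb_exists_in -ltNge => /forall_inP pos.
rewrite (big_setD1 i) //= ltr_pwDl //; first by rewrite ltNge pos.
by apply: sumr_ge0 => j /setD1P[_ jA]; rewrite ltW // ltNge pos.
Qed.

(* A random cell of A has no positive expected drift off the target loads, so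
   some cell of A does not increase the first-order part of sum E^2. *)
Lemma choose_cell (A : {set 'I_N}) (E : C -> R) (a b q : R) :
  (1 - theta) * N%:R <= #|A|%:R -> (forall v, 0 <= E v) ->
  0 <= a -> 0 <= b -> a + b <= q ->
  exists2 t, t \in A & exists E' : C -> R,
    [/\ forall v, 0 <= E' v,
        forall v, E v + cell_load a b (s t) v <=
          E' v + (1 + 2 * theta) / N%:R * (b * count1 v + a * count2 v)
      & \sum_v E' v ^+ 2 <= \sum_v E v ^+ 2 + 4 * #|C|%:R * q ^+ 2].
Proof.
move=> bigA E0 a0 b0 abq.
have NR : 0 < N%:R :> R by rewrite ltr0n.
have A0 : A != set0.
  rewrite -card_gt0 -(ltr0n R); apply: lt_le_trans bigA.
  by rewrite mulr_gt0 //; have := theta_le; lra.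
pose P v := b * count1 v + a * count2 v.
(* Restricting to [A] inflates the average load by at most [1 / (1 - theta)], which is at most
   [1 + 2 * theta] since [theta] is at most one half. *)
pose al := (1 + 2 * theta) / N%:R.
have al0 : 0 <= al by rewrite divr_ge0 //; have := theta_ge0; lra.
have P0 v : 0 <= P v by rewrite addr_ge0 // mulr_ge0.
pose dlt t v := cell_load a b (s t) v - al * P v.
have sumload v : \sum_(t in A) cell_load a b (s t) v <= P v.
  apply: (@le_trans _ _ (\sum_t cell_load a b (s t) v)).
    rewrite [X in X <= _]big_mkcond; apply: ler_sum => t _.
    by case: ifP => // _; rewrite addr_ge0 // mulr_ge0.
  rewrite big_split /= -!mulr_sumr /P /count1 /count2 -!sum1_card !natr_sum.
  by rewrite lerD // ler_wpM2l // [X in _ <= X]big_mkcond;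
    apply: ler_sum => t _; rewrite inE; case: (_ == v).
have bigal : 1 <= #|A|%:R * al.
  rewrite /al mulrA ler_pdivlMr // mul1r.
  have h : (1 - theta) * N%:R * (1 + 2 * theta) <= #|A|%:R * (1 + 2 * theta).
    by rewrite ler_wpM2r //; have := theta_ge0; lra.
  apply: le_trans h; have -> : (1 - theta) * N%:R * (1 + 2 * theta) =
    N%:R + theta * (1 - 2 * theta) * N%:R by ring.
  by rewrite lerDl mulr_ge0 // mulr_ge0 //; have := theta_le; lra.
have [t tA le0] : exists2 t, t \in A & \sum_v E v * dlt t v <= 0.
  apply: exists_le0 => //; rewrite exchange_big /=.
  apply: sumr_le0 => v _; rewrite -mulr_sumr mulr_ge0_le0 //.
  rewrite sumrB sumr_const subr_le0; apply: le_trans (sumload v) _.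
  rewrite -[_ *+ _]mulr_natl mulrA -[X in X <= _]mul1r ler_wpM2r //.
exists t => //; exists (fun v => Num.max 0 (E v + dlt t v)); split.
- by move=> v; rewrite le_max lexx.
- move=> v; rewrite -/(P v) -/al.
  have : E v + dlt t v <= Num.max 0 (E v + dlt t v) by rewrite le_max lexx orbT.
  by rewrite /dlt; lra.
have q0 : 0 <= q by apply: le_trans abq; rewrite addr_ge0.
have countN (f : 'I_N -> C) v : #|[set t | f t == v]|%:R <= N%:R :> R.
  by rewrite ler_nat; apply: leq_trans (max_card _) _; rewrite card_ord.
have alP v : al * P v <= 2 * q.
  have : P v <= (a + b) * N%:R.
    have := ler_wpM2l b0 (countN (fun t => (s t).1) v).
    have := ler_wpM2l a0 (countN (fun t => (s t).2) v).
    by rewrite /P /count1 /count2; lra.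
  move=> PN; apply: (@le_trans _ _ (al * (q * N%:R))).
    by rewrite ler_wpM2l // (le_trans PN) // ler_wpM2r.
  have -> : al * (q * N%:R) = (1 + 2 * theta) * q.
    by rewrite /al; field; rewrite gt_eqF.
  by rewrite ler_wpM2r //; have := theta_le; lra.
have dl v : dlt t v ^+ 2 <= 4 * q ^+ 2.
  have : - (2 * q) <= dlt t v <= 2 * q.
    have := alP v; have : 0 <= al * P v by rewrite mulr_ge0.
    rewrite /dlt /cell_load.
    by case: (_ == v); case: (_ == v) => /= *; apply/andP; split; lra.
  move=> /andP[l1 l2]; have : 0 <= (2 * q - dlt t v) * (2 * q + dlt t v).
    by rewrite mulr_ge0; lra.
  by lra.
apply: (@le_trans _ _ (\sum_v (E v ^+ 2 + 2 * (E v * dlt t v) + 4 * q ^+ 2))).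
  apply: ler_sum => v _; apply: (@le_trans _ _ ((E v + dlt t v) ^+ 2)).
    by rewrite /Num.max; case: ifP => // _; rewrite expr0n /= sqr_ge0.
  by have := dl v; lra.
rewrite !big_split /= -mulr_sumr sumr_const -[_ *+ _]mulr_natl.
by lra.
Qed.

End CellChoice.

(** * Embedding the tree block by block *)

Section Embedding.
Variables (R : realType) (V : finType) (e : rel V) (C : finType) (c : V -> C).
Variables (r : rel C) (i0 : C) (V0 : {set V}) (eps d rho theta omega : R).
Variables (T : finType) (rt : T) (p : T -> T) (dist : T -> nat).
Variables (col : pred T) (W : {set T}) (s : nat).
Variables (N : nat) (plan : 'I_N -> C * C).

Definition reserve i : {set V} := fiber c i :&: V0.
Definition bulk i : {set V} := fiber c i :\: V0.
Definition rich (Y : {set V}) (v : V) : bool :=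
  d * #|Y|%:R <= (deg_in e Y v)%:R.
(* An image of a vertex of the smaller class is good when it can be continued in
   most cells of the plan. *)
Definition good (v : V) : bool :=
  (1 - theta) * N%:R <= #|[set t | rich (reserve (plan t).1) v]|%:R.
Definition nA (S : {set T}) : R := #|[set x in S | col x]|%:R.
Definition nB (S : {set T}) : R := #|[set x in S | ~~ col x]|%:R.
Definition load (S : {set T}) (g : T -> V) (i : C) : R :=
  #|[set x in S | g x \in bulk i]|%:R.
Definition target (a b : R) (i : C) : R :=
  (1 + 2 * theta) / N%:R * (b * count1 R plan i + a * count2 R plan i).
Notation istop := (is_top p W).
Notation topof := (top p dist W).
Notation fsize i := (#|fiber c i|%:R : R).

Hypotheses (rtd : rooted rt p dist) (rW : rt \in W).
Hypothesis col_rt : col rt.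
Hypothesis col_p : forall x, x != rt -> col (p x) = ~~ col x.
Hypothesis cutW : forall x, x \in W -> ~~ col x -> p x \in W.
Hypothesis blocks : forall t, (#|[set x | topof x == t]| <= s)%N.
Hypotheses (r_sym : symmetric r).
Hypothesis typ : forall i j, r i j ->
  typical_pair e eps d (fiber c i) (fiber c j).
Hypotheses (N0 : (0 < N)%N).
Hypothesis planP : forall t, r i0 (plan t).1 && r (plan t).1 (plan t).2.
Hypotheses (theta_gt0 : 0 < theta) (theta_le : theta <= 2^-1).
Hypotheses (eps_ge0 : 0 <= eps) (eps_le : eps <= rho) (d_ge0 : 0 <= d).
Hypotheses (d_le1 : d <= 1) (omega_ge0 : 0 <= omega).
Hypothesis res_large : forall i j, r i j -> rho * fsize i <= #|reserve i|%:R.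
(** A [d] fraction of a set filling [rho] of the cluster keeps more than [s] vertices after removal
    of the images of tops and of the vertices unfit for continuation. *)
Hypothesis slack : forall i j, r i j ->
  #|[set x | istop x]|%:R + s%:R + (2 * eps + eps / theta) * fsize i
    < d * (rho * fsize i).
Hypothesis omegaP : 4 * #|C|%:R * s%:R * #|T|%:R <= omega ^+ 2.
Hypothesis capacity : forall i j, r i j ->
  target (nA setT) (nB setT) i + omega + rho * fsize i <= #|bulk i|%:R.

(* S is a union of blocks, embedded by g.  Tops of blocks lie in V0 and the
   other vertices outside, so that V0 stays almost unused.  E is the excess of
   the loads over the share of the plan due to S. *)
Record partial (S : {set T}) (g : T -> V) : Prop := Partial {
  partial_parent : forall x, x \in S -> p x \in S;
  partial_block : forall x y, x \in S -> topof x = topof y -> y \in S;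
  partial_inj : {in S &, injective g};
  partial_edge : forall x, x \in S -> x != rt -> e (g (p x)) (g x);
  partial_bulk : forall x, x \in S -> ~~ istop x -> g x \notin V0;
  partial_good : forall x, x \in S -> col x -> istop x -> good (g x);
  partial_rich : forall x, x \in S -> ~~ col x -> rich (reserve i0) (g x);
  partial_load : exists E : C -> R,
    [/\ forall i, 0 <= E i,
        forall i, load S g i <= E i + target (nA S) (nB S) i
      & \sum_i E i ^+ 2 <= 4 * #|C|%:R * s%:R * #|S|%:R] }.

Lemma rich_typical i j (Y : {set V}) : r i j -> Y \subset fiber c j ->
  rho * fsize j <= #|Y|%:R ->
  #|[set v in fiber c i | ~~ rich Y v]|%:R <= eps * fsize i.
Proof.
move=> rij sY lY; apply: le_trans (typ rij sY _); last first.
  by apply: le_trans lY; rewrite ler_wpM2r.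
rewrite ler_nat; apply: subset_leq_card; apply/subsetP => v.
by rewrite !inE => /andP[-> /=]; rewrite /rich -ltNge.
Qed.

Lemma res_fiber i : reserve i \subset fiber c i.
Proof. exact: subsetIl. Qed.

(** Double counting of pairs of a vertex and a cell for which it is not rich: a vertex that is not
    good fails for at least [theta * N] cells, and each cell fails for at most an [eps] fraction of
    the cluster. *)
Lemma few_not_good :
  #|[set v in fiber c i0 | ~~ good v]|%:R <= eps / theta * fsize i0.
Proof.
set B := [set v in _ | _].
pose bad v := [set t | ~~ rich (reserve (plan t).1) v].
have bigbad v : v \in B -> theta * N%:R <= #|bad v|%:R.
  rewrite inE /good -ltNge => /andP[_ lt].
  have : #|[set t | rich (reserve (plan t).1) v]|%:R + #|bad v|%:R = N%:R :> R.
    rewrite -natrD; congr _%:R; rewrite -[RHS]card_ord.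
    rewrite -[RHS](cardsC [set t | rich (reserve (plan t).1) v]).
    by congr (_ + _)%N; apply: eq_card => t; rewrite !inE.
  by move=> E; lra.
have NR : 0 < N%:R :> R by rewrite ltr0n.
rewrite mulrAC ler_pdivlMr // -(ler_pM2r NR) -mulrA.
apply: (@le_trans _ _ (\sum_(v in B) #|bad v|%:R)).
  apply: (@le_trans _ _ (\sum_(v in B) theta * N%:R)); last exact: ler_sum.
  by rewrite sumr_const -[X in _ <= X]mulr_natl.
have -> : \sum_(v in B) #|bad v|%:R =
    \sum_t #|[set v in B | ~~ rich (reserve (plan t).1) v]|%:R :> R.
  under eq_bigr => v _ do rewrite -sum1_card natr_sum big_mkcond.
  under [RHS]eq_bigr => t _ do rewrite -sum1_card natr_sum big_mkcond.
  rewrite big_mkcond [RHS]exchange_big /=; apply: eq_bigr => v _.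
  case: (boolP (v \in B)) => vB; last first.
    by rewrite big1 // => t _; rewrite in_set (negPf vB).
  by apply: eq_bigr => t _; rewrite [v \in _]in_set vB [t \in _]in_set.
apply: (@le_trans _ _ (\sum_(t < N) eps * fsize i0)); last first.
  by rewrite sumr_const card_ord -[X in X <= _]mulr_natr.
apply: ler_sum => t _; have /andP[r1 r2] := planP t.
apply: le_trans (rich_typical r1 (res_fiber _) (res_large r2)).
rewrite ler_nat; apply: subset_leq_card; apply/subsetP => v.
by rewrite !inE => /andP[/andP[-> _] ->].
Qed.

Section Partial.
Variables (S : {set T}) (g : T -> V).
Hypothesis inv : partial S g.
Let used := g @: S.
Definition free i := bulk i :\: used.

Lemma used_reserve i :
  #|reserve i :&: used|%:R <= #|[set x | istop x]|%:R :> R.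
Proof.
rewrite ler_nat; apply: leq_trans (leq_imset_card g _).
apply: subset_leq_card; apply/subsetP => v; rewrite in_setI => /andP[vr].
case/imsetP => x xS vE; apply/imsetP; exists x => //; rewrite inE.
apply: contraLR vr => nt; rewrite in_setI negb_and vE.
by rewrite (partial_bulk inv xS nt) orbT.
Qed.

Lemma nA_le : nA S <= nA setT.
Proof.
rewrite ler_nat; apply: subset_leq_card; apply/subsetP => x.
by rewrite !inE => /andP[_ ->].
Qed.

Lemma nB_le : nB S <= nB setT.
Proof.
rewrite ler_nat; apply: subset_leq_card; apply/subsetP => x.
by rewrite !inE => /andP[_ ->].
Qed.

(** The bound on the sum of squares and [omegaP] keep each single excess below [omega]; [capacity]
    leaves the rest free. *)
Lemma free_large i j : r i j -> rho * fsize i <= #|free i|%:R.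
Proof.
move=> rij; have [E [E0 lE sE]] := partial_load inv.
have NR : 0 < N%:R :> R by rewrite ltr0n.
have Ew : E i <= omega.
  rewrite -(@ler_pXn2r _ 2) ?nnegrE //.
  apply: (@le_trans _ _ (\sum_i E i ^+ 2)).
    by rewrite (bigD1 i) //= lerDl sumr_ge0 // => k _; rewrite sqr_ge0.
  apply: le_trans sE (le_trans _ omegaP).
  by rewrite ler_wpM2l ?mulr_ge0 // ler_nat max_card.
have tle : target (nA S) (nB S) i <= target (nA setT) (nB setT) i.
  rewrite /target ler_wpM2l //.
    by rewrite divr_ge0 //; have := theta_gt0; lra.
  by rewrite lerD // ler_wpM2r // ?nA_le ?nB_le.
have : #|bulk i|%:R <= load S g i + #|free i|%:R.
  rewrite /free /load -natrD ler_nat -(cardsID used (bulk i)) leq_add2r.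
  apply: leq_trans (leq_imset_card g _); apply: subset_leq_card.
  apply/subsetP => v; rewrite in_setI => /andP[vb /imsetP[x xS vE]].
  by apply/imsetP; exists x => //; rewrite inE xS -vE.
by have := lE i; have := capacity rij; lra.
Qed.

Lemma free_fiber i : free i \subset fiber c i.
Proof. by apply: subset_trans (subsetDl _ _) (subsetDl _ _). Qed.

Section Block.
Variables (i j : C) (t : T).
Hypotheses (ri : r i0 i) (rij : r i j) (top_t : istop t) (tS : t \notin S).
Hypothesis ptS : t != rt -> p t \in S.
Hypothesis start : ~~ col t -> rich (reserve i) (g (p t)).
Let X : {set T} := [set x | topof x == t].

(** Inside a block, parent and child always land in adjacent clusters. *)
Definition home y := if istop y then (if col y then i0 else i)
                     else (if col y then j else i).
Definition room y := (if istop y then reserve (home y) else bulk (home y))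
                     :\: used.
(** What later vertices ask of an image. The [free] sets serve children in the same block. A top
    outside [col] has a seed as parent, so in [col] only tops must be good; a top in [col] may hang
    from any vertex outside [col], so all of these must be rich in the reserve of [i0]. *)
Definition ok y u := if col y then rich (free i) u && (istop y ==> good u)
                     else rich (free j) u && rich (reserve i0) u.
Definition cand y := [set u in room y | ok y u].

Lemma r_home y : exists k, r (home y) k.
Proof.
rewrite /home; case: istop; case: (col y).
- by exists i. - by exists j. - by exists i; rewrite r_sym. - by exists j.
Qed.

Lemma bad_le y : #|[set u in fiber c (home y) | ~~ ok y u]|%:R <=
  (2 * eps + eps / theta) * fsize (home y).
Proof.
have et : 0 <= eps / theta by rewrite divr_ge0 // ltW.
have ub k (P Q : pred V) (x1 x2 : R) :
  #|[set u in fiber c k | ~~ P u]|%:R <= x1 * fsize k ->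
  #|[set u in fiber c k | ~~ Q u]|%:R <= x2 * fsize k ->
  x1 + x2 <= 2 * eps + eps / theta ->
  #|[set u in fiber c k | ~~ (P u && Q u)]|%:R <=
    (2 * eps + eps / theta) * fsize k.
  move=> h1 h2 h3; have h4 := ler_wpM2r (ler0n R #|fiber c k|) h3.
  apply: le_trans h4; rewrite mulrDl; apply: le_trans (lerD h1 h2).
  rewrite -natrD ler_nat; apply: leq_trans (leq_card_setU _ _).
  apply: subset_leq_card; apply/subsetP => u; rewrite !inE negb_and.
  by case/andP => -> /orP[] -> //; rewrite orbT.
have rji : r j i by rewrite r_sym.
have rii0 : r i i0 by rewrite r_sym.
have none k : #|[set u in fiber c k | ~~ true]|%:R <= 0 * fsize k :> R.
  rewrite mul0r (_ : [set u in _ | _] = set0) ?cards0 //.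
  by apply/setP => u; rewrite !inE andbF.
rewrite /home /ok; case: istop; case: (col y) => /=.
- apply: ub (rich_typical ri (free_fiber _) (free_large rij)) few_not_good _.
  by have := eps_ge0; lra.
- apply: ub (rich_typical rij (free_fiber _) (free_large rji))
    (rich_typical rii0 (res_fiber _) (res_large ri)) _.
  by have := eps_ge0; lra.
- apply: ub (rich_typical rji (free_fiber _) (free_large rij)) (none j) _.
  by have := eps_ge0; lra.
- apply: ub (rich_typical rij (free_fiber _) (free_large rji))
    (rich_typical rii0 (res_fiber _) (res_large ri)) _.
  by have := eps_ge0; lra.
Qed.

(* Y is what was available for y before some used vertices were removed. *)
Lemma cand_large y (Y : {set V}) (P : pred V) (x : R) :
  Y \subset fiber c (home y) ->
  #|Y :\: room y|%:R <= x ->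
  rho * fsize (home y) <= #|Y|%:R -> d * #|Y|%:R <= #|[set u in Y | P u]|%:R ->
  x <= #|[set x | istop x]|%:R ->
  s%:R < #|[set u in cand y | P u]|%:R :> R.
Proof.
move=> sY lost big dP xle; have [k rk] := r_home y.
have h1 := slack rk; have h2 := bad_le y.
have h3 := ler_wpM2l d_ge0 big.
suff : #|[set u in Y | P u]|%:R <= #|[set u in cand y | P u]|%:R +
   #|Y :\: room y|%:R + #|[set u in fiber c (home y) | ~~ ok y u]|%:R :> R.
  by lra.
rewrite -!natrD ler_nat.
apply: leq_trans (leq_trans (leq_card_setU _ _) (leq_add _ (leqnn _)));
  last exact: leq_card_setU.
apply: subset_leq_card; apply/subsetP => u; rewrite inE => /andP[uY Pu].
rewrite 2!in_setU -orbA; have uf := subsetP sY u uY; apply/or3P.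
case ur: (u \in room y); last by apply: Or32; rewrite in_setD ur uY.
case uo: (ok y u); last by apply: Or33; rewrite inE uf uo.
by apply: Or31; rewrite inE Pu andbT inE ur uo.
Qed.

Lemma block_parent x : x \in X -> x != t ->
  [/\ ~~ istop x, p x \in X, x != rt & dist x = (dist (p x)).+1].
Proof.
rewrite inE (topE rtd rW); case: ifPn => [_ /eqP ->|nt /eqP E xt].
  by rewrite eqxx.
have xr : x != rt by apply: contraNneq nt => ->; rewrite /is_top rW.
split=> //; first by rewrite inE E.
by case: rtd => _ _; apply.
Qed.

Lemma block_ext x v : x \in X -> x != t -> v \in cand (p x) ->
  (#|X| <= #|[set u in cand x | e v u]|)%N.
Proof.
move=> xX xt; have [nt _ xr _] := block_parent xX xt.
rewrite inE => /andP[_ okv]; have [k rk] := r_home x.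
have rv : rich (free (home x)) v.
  move: okv; rewrite /ok /home (negPf nt) col_p //.
  by case: (col x) => /= /andP[].
apply: leq_trans (blocks t) _; rewrite -(ler_nat R) ltW //.
apply: (@cand_large x (free (home x)) (e v) 0) => //.
- exact: free_fiber.
- by rewrite /room (negPf nt) setDv cards0.
- exact: free_large rk.
Qed.

Lemma block_start : exists2 v, v \in cand t & (t != rt -> e (g (p t)) v).
Proof.
have [k rk] := r_home t.
pose P v := (t != rt) ==> e (g (p t)) v.
have : s%:R < #|[set u in cand t | P u]|%:R :> R.
  apply: (@cand_large t (reserve (home t)) P _ _ _ _ _ (used_reserve (home t))).
  - exact: res_fiber.
  - rewrite /room top_t.
    by rewrite setDDr setDv set0U.
  - exact: res_large rk.
  rewrite /P; have [tr|tr] /= := eqVneq t rt.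
    rewrite (_ : [set u in _ | true] = reserve (home t)); last first.
      by apply/setP => u; rewrite !inE andbT.
    by rewrite -[X in _ <= X]mul1r ler_wpM2r.
  have pS := ptS tr; rewrite /home top_t.
  case: (boolP (col t)) => ct; last exact: start.
  by apply: (partial_rich inv pS); rewrite col_p // ct.
move=> h; have : (0 < #|[set u in cand t | P u]|)%N.
  by rewrite -(ltr0n R); apply: le_lt_trans h.
case/card_gt0P => v; rewrite inE => /andP[vc Pv].
by exists v => // tr; move: Pv; rewrite /P tr.
Qed.

Lemma top_id : topof t = t.
Proof. by rewrite (topE rtd rW) top_t. Qed.

Lemma block_notin x : x \in X -> x \notin S.
Proof.
rewrite inE => /eqP xt; apply: contra tS => xS.
by apply: (partial_block inv xS); rewrite xt top_id.
Qed.

Lemma extend_block (E : C -> R) :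
  (forall k, 0 <= E k) ->
  (forall k, load S g k + cell_load (nA X) (nB X) (i, j) k <=
     E k + target (nA S + nA X) (nB S + nB X) k) ->
  \sum_k E k ^+ 2 <= 4 * #|C|%:R * s%:R * #|S :|: X|%:R ->
  exists g', partial (S :|: X) g'.
Proof.
move=> E0 lE sE; have [v0 v0c v0e] := block_start.
have tX : t \in X by rewrite inE top_id.
have pX x : x \in X -> x != t -> p x \in X /\ (dist (p x) < dist x)%N.
  by move=> xX xt; have [_ h _ ->] := block_parent xX xt.
have [h [ht hinj hc he]] := greedy_block tX pX block_ext v0c.
pose g' x := if x \in X then h x else g x.
have gS x : x \in S -> g' x = g x.
  by move=> xS; rewrite /g'; case: ifP => // /block_notin; rewrite xS.
have gX x : x \in X -> g' x = h x by rewrite /g' => ->.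
have hroom x : x \in X -> h x \in room x by move/hc; rewrite inE => /andP[].
have hok x : x \in X -> ok x (h x) by move/hc; rewrite inE => /andP[].
have cross x y : x \in X -> y \in S -> h x <> g y.
  move=> xX yS E1; have := hroom x xX.
  by rewrite in_setD E1 imset_f.
have disj (P : pred T) : #|[set x in S :|: X | P x]|%:R =
    #|[set x in S | P x]|%:R + #|[set x in X | P x]|%:R :> R.
  rewrite -natrD -cardsUI [X in (_ + #|pred_of_set X|)%N](_ : _ = set0).
    rewrite cards0 addn0; congr _%:R; apply: eq_card => x.
    by rewrite !inE; case: (P x); rewrite ?andbT ?andbF.
  apply/setP => x; rewrite in_set0; apply/negP => /setIP[].
  rewrite 2!in_set => /andP[xS _] /andP[xX _].
  by have := block_notin xX; rewrite xS.
exists g'; split.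
- move=> x; rewrite !in_setU => /orP[xS|xX].
    by rewrite (partial_parent inv xS).
  have [xt|xt] := eqVneq x t; last first.
    by have [_ ->] := block_parent xX xt; rewrite orbT.
  have [tr|tr] := eqVneq t rt; last by rewrite xt ptS.
  by have [pr _ _] := rtd; rewrite xt tr pr -tr tX orbT.
- move=> x y; rewrite !in_setU => /orP[xS|xX] E1.
    by rewrite (partial_block inv xS E1).
  by apply/orP; right; move: xX; rewrite !inE E1.
- move=> x y; rewrite !in_setU => /orP[xS|xX] /orP[yS|yX].
  + by rewrite !gS //; exact: (partial_inj inv).
  + by rewrite gS // gX // => /esym /(cross _ _ yX xS).
  + by rewrite gX // gS // => /(cross _ _ xX yS).
  + by rewrite !gX //; exact: hinj.
- move=> x; rewrite !in_setU => /orP[xS|xX] xr.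
    by rewrite !gS ?(partial_parent inv xS) // (partial_edge inv).
  have [xt|xt] := eqVneq x t; last first.
    by rewrite !gX ?he //; have [_ ->] := block_parent xX xt.
  by rewrite (gX x) // xt ht gS; [apply: v0e|apply: ptS]; rewrite -xt.
- move=> x; rewrite !in_setU => /orP[xS|xX] nt.
    by rewrite gS // (partial_bulk inv).
  rewrite gX //; have := hroom x xX; rewrite /room (negPf nt).
  by rewrite in_setD in_setD => /and3P[].
- move=> x; rewrite !in_setU => /orP[xS|xX] cx tx.
    by rewrite gS // (partial_good inv).
  by rewrite gX //; have := hok x xX; rewrite /ok cx tx => /andP[].
- move=> x; rewrite !in_setU => /orP[xS|xX] cx.
    by rewrite gS // (partial_rich inv).
  by rewrite gX //; have := hok x xX; rewrite /ok (negPf cx) => /andP[].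
exists E; split=> // k.
have -> : nA (S :|: X) = nA S + nA X by exact: disj.
have -> : nB (S :|: X) = nB S + nB X by exact: disj.
apply: le_trans (lE k); rewrite {1}/load disj; apply: lerD.
  rewrite ler_nat; apply: subset_leq_card; apply/subsetP => x.
  by rewrite !in_set => /andP[xS]; rewrite gS // xS.
(* Tops lie in the reserve and carry no load; of the other vertices, those outside [col] load [i]
   and those in [col] load [j]. *)
apply: (@le_trans _ _ (#|[set x in X | (i == k) && ~~ col x]|%:R +
                       #|[set x in X | (j == k) && col x]|%:R)).
  rewrite -natrD ler_nat; apply: leq_trans (leq_card_setU _ _).
  apply: subset_leq_card; apply/subsetP => x.
  rewrite in_setU 3!in_set => /andP[xX]; rewrite gX // xX /= => hk.
  have := hroom x xX; rewrite /room /home in_setD => /andP[_].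
  case: ifP => tx.
    by move: hk; rewrite in_setD in_setI => /andP[/negPf -> _]; rewrite andbF.
  move: hk; rewrite !inE => /andP[_ /eqP <-] /andP[_ /eqP ->].
  by rewrite tx; case: (col x); rewrite eqxx ?orbT.
have z : [set x in X | false] = set0.
  by apply/setP => x; rewrite in_set in_set0 andbF.
rewrite /cell_load /nA /nB /=; apply: lerD.
  by case: (i == k) => /=; rewrite ?mulr1 // mulr0 z cards0.
by case: (j == k) => /=; rewrite ?mulr1 // mulr0 z cards0.
Qed.

End Block.

(** A vertex outside [S] closest to the root starts a new block, for otherwise it would share the
    block of its parent, which is in [S]. *)
Lemma extend_partial : S != setT ->
  exists S' g', partial S' g' /\ (#|S| < #|S'|)%N.
Proof.
move=> SnT.
have [t0 t0S] : exists t, t \notin S.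
  by apply/existsP; rewrite -negb_forall; apply: contra SnT => /forallP all;
    apply/eqP/setP => x; rewrite all inE.
case: (@arg_minnP _ t0 (fun t => t \notin S) dist t0S) => t tS mint.
have ptS : t != rt -> p t \in S.
  move=> tr; apply: contraT => /mint.
  by case: rtd => _ _ /(_ _ tr) ->; rewrite ltnn.
have top_t : istop t.
  apply: contraT => nt; have tr : t != rt.
    by apply: contraNneq nt => ->; rewrite /is_top rW.
  move: tS; rewrite (partial_block inv (ptS tr)) //.
  by rewrite [in RHS](topE rtd rW) (negPf nt).
pose X : {set T} := [set x | topof x == t].
(* The admissible cells: if [t] is outside [col], its parent is a seed, hence has a good image, and
   most cells remain. *)
pose G := [set n | col t || rich (reserve (plan n).1) (g (p t))].
have bigG : (1 - theta) * N%:R <= #|G|%:R.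
  case: (boolP (col t)) => ct.
    rewrite (_ : G = setT); last by apply/setP => n; rewrite !inE ct.
    rewrite cardsT card_ord; have := mulr_ge0 (ltW theta_gt0) (ler0n R N).
    by lra.
  have tr : t != rt by apply: contraNneq ct => ->.
  have cpt : col (p t) by rewrite col_p.
  have ptW : p t \in W by case/orP: top_t => // /cutW; apply.
  have := partial_good inv (ptS tr) cpt; rewrite /is_top ptW => /(_ isT).
  rewrite /good (_ : [set n | _] = G) //.
  by apply/setP => n; rewrite !inE (negPf ct).
have [E [E0 lE sE]] := partial_load inv.
have sumX : nA X + nB X <= #|X|%:R.
  rewrite -natrD ler_nat -(cardsID [set x | col x] X); apply: leq_add;
    by apply: subset_leq_card; apply/subsetP => x; rewrite !inE // andbC.
have [n nG [E' [E'0 lE' sE']]] :=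
  choose_cell plan N0 (ltW theta_gt0) theta_le bigG E0
  (ler0n R _ : 0 <= nA X) (ler0n R _ : 0 <= nB X)
  sumX.
have /andP[ri rij] := planP n.
have start : ~~ col t -> rich (reserve (plan n).1) (g (p t)).
  by move=> ct; move: nG; rewrite inE (negPf ct).
have dXS x : x \in X -> x \notin S by exact: block_notin.
have cSX : #|S :|: X| = (#|S| + #|X|)%N.
  rewrite cardsU (_ : S :&: X = set0) ?cards0 ?subn0 //.
  apply/setP => x; rewrite in_setI in_set0.
  by apply/negP => /andP[xS /dXS]; rewrite xS.
have [||g' pg'] := @extend_block _ _ t ri rij top_t tS ptS start E' E'0.
- move=> k; have := lE' k; have := lE k; rewrite /target -/X.
  set al := _ / _; case: (plan n) => i j /= h1 h2.
  by lra.
(* The increment is quadratic in [#|X|], but blocks have at most [s] vertices, so the bound stays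
   linear in the number of embedded vertices. *)
- apply: le_trans sE' _; rewrite cSX natrD.
  have h : #|X|%:R ^+ 2 <= s%:R * #|X|%:R :> R.
    by rewrite expr2 ler_wpM2r // ler_nat blocks.
  have := ler_wpM2l (mulr_ge0 (ler0n R 4) (ler0n R #|C|)) h.
  by lra.
exists (S :|: X), g'; split=> //.
rewrite cSX -[X in (X < _)%N]addn0 ltn_add2l card_gt0.
by apply/set0Pn; exists t; rewrite inE (topE rtd rW) top_t.
Qed.

End Partial.

Lemma embed_tree (v0 : V) : exists g, partial setT g.
Proof.
suff main n : exists S g, partial S g /\ ((S == setT) || (n <= #|S|)%N).
  have [S [g [pS /orP[/eqP E|big]]]] := main #|T|.+1.
    by exists g; rewrite -E.
  by have := leq_trans big (max_card _); rewrite ltnn.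
elim: n => [|n [S [g [pS big]]]].
  exists set0, (fun=> v0); split; last by rewrite orbT.
  split=> [x|x y|x|x|x|x|x|]; rewrite ?inE //.
  exists (fun=> 0); split=> // [i|].
    rewrite /load /target /nA /nB.
    have z (P : pred T) : #|[set x in set0 | P x]| = 0%N.
      by apply: eq_card0 => x; rewrite !inE.
    by rewrite !z !mul0r addr0 mulr0 addr0.
  by rewrite cards0 mulr0 big1 // => i _; rewrite expr0n.
have [E|SnT] := eqVneq S setT; first by exists S, g; rewrite E eqxx -E.
have [S' [g' [pg' lt]]] := extend_partial pS SnT.
exists S', g'; split=> //; rewrite (leq_trans _ lt) ?orbT // ltnS.
by move: big; rewrite (negPf SnT).
Qed.

End Embedding.

Lemma edges_le_pairs (R : realType) (G : sgraph) :
  2 * #|edges G|%:R <= \sum_z edge_ind R (@adj G) z.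
Proof.
pose P := [set z : G * G | adj z.1 z.2].
have -> : \sum_z edge_ind R (@adj G) z = #|P|%:R.
  rewrite -sum1_card natr_sum [RHS]big_mkcond; apply: eq_bigr => z _.
  by rewrite inE /edge_ind; case: (adj _ _).
pose ends (z : G * G) : {set G} := [set z.1; z.2].
rewrite -natrM ler_nat -[#|P|]sum1_card.
rewrite (partition_big ends (mem (edges G))) /=; last first.
  by move=> z zP; apply/imsetP; exists z; rewrite inE in zP; rewrite ?inE.
rewrite mulnC -sum_nat_const; apply: leq_sum => E /imsetP[[x y] xy ->].
rewrite inE /= in xy; rewrite sum1dep_card.
have xney : x != y by apply: contraTneq xy => ->; rewrite adj_irrefl.
rewrite -[2%N](_ : #|[set (x, y); (y, x)]| = 2%N); last first.
  by rewrite cards2 xpair_eqE negb_and xney.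
apply: subset_leq_card; apply/subsetP => z; rewrite !inE /ends.
case/orP => /eqP -> /=; first by rewrite xy eqxx.
by rewrite adj_sym xy setUC eqxx.
Qed.

Lemma reserve_exists (V C : finType) (c : V -> C) (m : C -> nat) :
  (forall i, m i <= #|fiber c i|)%N ->
  exists V0 : {set V}, forall i, #|reserve c V0 i| = m i.
Proof.
move=> mle.
have /fin_all_exists[D HD] i : exists D : {set V},
    D \subset fiber c i /\ #|D| = m i.
  have /card_geqP[q [uq sq qf]] := mle i; exists [set v in q]; split.
    by apply/subsetP => v; rewrite inE => /qf.
  by rewrite -sq cardsE; apply/card_uniqP.
exists [set v | v \in D (c v)] => i; have [/subsetP sD <-] := HD i.
apply: eq_card => v; rewrite !inE; apply/andP/idP => [[/eqP ->]//|vD].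
by have := sD v vD; rewrite inE => /eqP ->.
Qed.

(** * Choice of the constants *)

Section Assembly.
Variables (R : realType) (eta mu : R) (M : nat).
Hypotheses (eta_gt0 : 0 < eta) (eta_le1 : eta <= 1) (mu_gt0 : 0 < mu).

(** [gap] serves as density, share of the reserve and [theta], and [tol] as regularity parameter.
    For a cluster on an edge of the reduced graph, [sigma * n] is at most [gap ^+ 2] times its size.
    Blocks have at most [beta * k] vertices: the second bound in [beta] keeps this below
    [sigma * n / 4], the third controls the excess [omega]. The choice of [gamma] limits the number
    of tops. *)
Definition gap : R := eta / 32.
Definition tol : R := gap ^+ 3 / 12.
Definition sigma : R := gap * (gap * mu).
Definition beta : R :=
  Num.min 1 (Num.min (sigma / 4) ((gap * mu) ^+ 2 / (4 * (M%:R + 1)))).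
Definition gamma : R := Num.min beta (sigma * beta / 48).

Lemma gap_bounds : 0 < gap /\ gap <= 32^-1.
Proof. by have := eta_gt0; have := eta_le1; rewrite /gap; split; lra. Qed.

Lemma sigma_gt0 : 0 < sigma.
Proof. have [d0 _] := gap_bounds; exact: mulr_gt0 d0 (mulr_gt0 d0 mu_gt0). Qed.

Lemma beta_bounds : [/\ 0 < beta, beta <= 1, beta <= sigma / 4 &
  4 * M%:R * beta <= (gap * mu) ^+ 2].
Proof.
have [d0 _] := gap_bounds; have s0 := sigma_gt0.
have M1 : 0 < 4 * (M%:R + 1) :> R by have := ler0n R M; lra.
have b0 : 0 < beta.
  rewrite /beta !lt_min ltr01 divr_gt0 //=.
  by rewrite divr_gt0 // exprn_gt0 // (mulr_gt0 d0 mu_gt0).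
split; first by [].
- by rewrite /beta ge_min lexx.
- by rewrite /beta !ge_min lexx orbT.
have : beta <= (gap * mu) ^+ 2 / (4 * (M%:R + 1)).
  by rewrite /beta !ge_min lexx !orbT.
by rewrite ler_pdivlMr //; lra.
Qed.

Lemma gamma_bounds : [/\ 0 < gamma, gamma <= beta & gamma <= sigma * beta / 48].
Proof.
have [b0 _ _ _] := beta_bounds; have s0 := sigma_gt0.
split.
- by rewrite /gamma lt_min b0 divr_gt0 // mulr_gt0.
- by rewrite /gamma ge_min lexx.
- by rewrite /gamma ge_min lexx orbT.
Qed.

Lemma embed_in_host (G T : sgraph) (C : finType) (c : G -> C) (r : rel C)
    (i0 : C) :
  (#|C| <= M)%N -> (#|T| <= #|G|)%N -> (1 < #|T|)%N -> is_tree T ->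
  (max_degree T)%:R <= gamma * #|T|%:R ->
  host (@adj G) tol gap mu (#|T|%:R + eta / 2 * #|G|%:R) c r i0 ->
  contains_subgraph G T.
Proof.
move=> CM TG T1 treeT degT [r_sym r_size r_typ r_i0 r_nbr].
have [rt [p [dist [col [rtd tedge padj [col_rt col_p] halves]]]]] :=
  tree_rooting treeT T1.
have [d0 d1] := gap_bounds; have s0 := sigma_gt0.
have [b0 b1 bs bM] := beta_bounds; have [g0 gb gs] := gamma_bounds.
set k : R := #|T|%:R in degT r_i0 r_nbr.
set n : R := #|G|%:R in r_size r_i0 r_nbr.
have kn : k <= n by rewrite ler_nat.
have k0 : 0 < k by rewrite ltr0n ltnW.
have n0 : 0 < n by apply: lt_le_trans kn.
(* An edge of T forces gamma k >= 1, so that k and n are automatically large. *)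
have [x1 x1r] : exists x1, x1 != rt.
  apply/existsP; rewrite -negb_forall; apply: contraL T1 => /forallP all1.
  rewrite -leqNgt; apply/card_le1_eqP => x y _ _.
  by rewrite (eqP (all1 x)) (eqP (all1 y)).
have deg1 : (1 <= max_degree T)%N.
  apply: leq_trans (leq_bigmax x1); rewrite card_gt0; apply/set0Pn.
  by exists (p x1); rewrite inE padj.
have gk : 1 <= gamma * k by apply: le_trans degT; rewrite ler1n.
have bk : 1 <= beta * k by apply: le_trans gk _; rewrite ler_wpM2r // ltW.
pose s := Num.truncn (beta * k).
have sle : s%:R <= beta * k by rewrite truncn_le; lra.
have sgt : beta * k < s%:R + 1 by rewrite natr1; apply: truncnS_gt.
have sS : (0 < s)%N by rewrite /s truncn_gt0.
have s1 : 1 <= s%:R :> R by rewrite ler1n.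
have degp x : (#|[set y | (y != rt) && (p y == x)]| <= max_degree T)%N.
  apply: leq_trans (leq_bigmax x); apply: subset_leq_card.
  apply/subsetP => y; rewrite !inE => /andP[/padj + /eqP <-].
  by rewrite adj_sym.
have [W [rW cutW blocks tops]] := cut_tree rtd col_rt col_p sS degp.
pose tau : R := #|[set x | is_top p W x]|%:R.
have tau0 : 0 <= tau by [].
(* The product [tau * s] is at most [6 * gamma * k ^+ 2], and [s] is at least [beta * k / 2]; the 48
   in [gamma] turns this into the quarter. *)
have tau_le : tau <= sigma * n / 4.
  have topsR : tau * s%:R <= (2 * k + s%:R) * ((max_degree T)%:R + 1).
    by rewrite /tau /k natr1 -!natrM -natrD -natrM ler_nat.
  have sk : s%:R <= k by apply: le_trans sle _; rewrite ger_pMl.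
  have h1 : (2 * k + s%:R) * ((max_degree T)%:R + 1) <=
      (3 * k) * (2 * (gamma * k)).
    by apply: ler_pM; [lra|rewrite addr_ge0|lra|lra].
  have h2 : tau * (beta * k) <= tau * (2 * s%:R) by rewrite ler_wpM2l //; lra.
  have h3 : gamma * k * k <= sigma * beta / 48 * k * k.
    by rewrite !ler_wpM2r // ltW.
  have h4 : (beta * k) * tau <= (beta * k) * (sigma * k / 4) by lra.
  have bk0 : 0 < beta * k by lra.
  rewrite (ler_pM2l bk0) in h4; apply: le_trans h4 _.
  by have := ler_wpM2l (ltW s0) kn; lra.
pose a := nA R col [set: T]; pose b := nB R col [set: T].
have a0 : 0 <= a by []. have b0' : 0 <= b by [].
have abk : a + b = k.
  rewrite /a /b /nA /nB -natrD; congr _%:R.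
  rewrite -(cardsC [set y | col y]).
  by congr (_ + _)%N; apply: eq_card => y; rewrite !inE.
have ab : a <= b.
  rewrite ler_nat; apply: leq_trans (leq_trans _ halves) _;
  by apply: subset_leq_card; apply/subsetP => x; rewrite !inE.
have etad : eta = 32 * gap by rewrite /gap; field.
have f0 i : 0 <= #|fiber c i|%:R :> R by [].
have act i j : r i j -> mu * n <= #|fiber c i|%:R by exact: r_size.
have fn i : #|fiber c i|%:R <= n by rewrite ler_nat max_card.
(* The withheld share [8 * gap] pays for the reserve, the factor [1 + 2 * theta] in [target], the
   excess [omega], the error of the plan and the part that must stay free. *)
pose cap i : R := (1 - 8 * gap) * #|fiber c i|%:R.
have K0 : k <= (1 - 8 * gap) * (k + eta / 2 * n).
  have := ler_wpM2l (ltW d0) kn.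
  have := ler_wpM2r (mulr_ge0 (ltW d0) (ltW n0)) d1.
  by have := mulr_gt0 d0 n0; rewrite etad; lra.
have c8 : 0 <= 1 - 8 * gap by lra.
have [|||||||N [plan [N0 planP load_le]]] :=
    @fractional_plan R C r i0 cap a b _ a0 b0' _ ab _ _ n _ _
      (gap / 2 * (mu * n)) _.
- by move=> v; rewrite mulr_ge0.
- by rewrite abk.
- by rewrite abk /cap -mulr_sumr; apply: le_trans K0 _; rewrite ler_wpM2l.
- move=> i /r_nbr h; rewrite abk /cap -mulr_sumr mulrCA.
  by apply: le_trans K0 _; rewrite ler_wpM2l.
- move=> v; apply: le_trans (fn v).
  by have := mulr_ge0 (ltW d0) (f0 v); rewrite /cap; lra.
- by rewrite abk.
- by rewrite !mulr_gt0 // invr_gt0.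
(* Rounding up gives the reserve at least its share; the minimum handles an empty cluster. *)
pose m i := minn (Num.truncn (gap * #|fiber c i|%:R)).+1 #|fiber c i|.
have [V0 V0P] : exists V0 : {set G}, forall i, #|reserve c V0 i| = m i.
  by apply: reserve_exists => i; rewrite geq_minr.
have df0 i : 0 <= gap * #|fiber c i|%:R by rewrite mulr_ge0 // ltW.
have res_ge i : gap * #|fiber c i|%:R <= #|reserve c V0 i|%:R.
  rewrite V0P /m; case: leqP => _; first exact/ltW/truncnS_gt.
  by have := ler_wpM2r (f0 i) d1; have := f0 i; lra.
(* Needed to absorb the 1 lost in rounding up the reserve; it follows from [gk]. *)
have dmn1 : 1 <= gap * (mu * n).
  have h1 : 1 <= sigma * beta / 48 * k.
    by apply: le_trans gk _; rewrite ler_wpM2r // ltW.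
  have h2 : sigma * k * beta <= sigma * k * 1.
    by rewrite ler_wpM2l // (mulr_ge0 (ltW s0) (ltW k0)).
  have h3 : sigma * k <= sigma * n by rewrite ler_wpM2l // ltW.
  have dmn := mulr_ge0 (ltW d0) (mulr_ge0 (ltW mu_gt0) (ltW n0)).
  have h4 : gap * (gap * (mu * n)) <= 32^-1 * (gap * (mu * n)).
    by rewrite ler_wpM2r.
  by move: h1 h2 h3; rewrite /sigma; lra.
have dact i j : r i j -> gap * (mu * n) <= gap * #|fiber c i|%:R.
  by move=> rij; rewrite ler_wpM2l ?(act _ _ rij) // ltW.
have res_le i j : r i j -> #|reserve c V0 i|%:R <= 2 * (gap * #|fiber c i|%:R).
  move=> rij; apply: (@le_trans _ _ (Num.truncn (gap * #|fiber c i|%:R)).+1%:R).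
    by rewrite V0P ler_nat geq_minl.
  have := dact _ _ rij; rewrite -natr1.
  have : (Num.truncn (gap * #|fiber c i|%:R))%:R <= gap * #|fiber c i|%:R.
    by rewrite truncn_le.
  by lra.
have bulkE i : #|bulk c V0 i|%:R = #|fiber c i|%:R - #|reserve c V0 i|%:R :> R.
  apply/eqP; rewrite eq_sym subr_eq -natrD eqr_nat addnC.
  by rewrite /reserve /bulk cardsID.
have [v0 _] : exists v0 : G, v0 \in G.
  by apply/card_gt0P; apply: leq_trans TG; apply: ltnW.
have NR : 0 < N%:R :> R by rewrite ltr0n.
have [||||||||g pg] := @embed_tree R G (@adj G) C c r i0 V0
  tol gap gap gap (gap * (mu * n))
  T rt p dist col W s N plan rtd rW col_rt col_p cutW blocks r_sym r_typ N0
  planP d0 _ _ _ (ltW d0) _ _ (fun i j _ => res_ge i) _ _ _ v0.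
- by lra.
- by rewrite /tol divr_ge0 // exprn_ge0 // ltW.
- have : gap ^+ 3 <= gap * 1.
    by rewrite exprS ler_wpM2l ?exprn_ile1 ?ltW //; lra.
  by rewrite /tol; lra.
- by lra.
- exact: mulr_ge0 (ltW d0) (mulr_ge0 (ltW mu_gt0) (ltW n0)).
- move=> i j rij; have h1 := dact i j rij; set F : R := #|fiber c i|%:R in h1 *.
  have -> : tol / gap = gap ^+ 2 / 12 by rewrite /tol; field; rewrite gt_eqF.
  have h2 : gap * (gap * (mu * n)) <= gap * (gap * F).
    by rewrite ler_wpM2l // ltW.
  have dF0 : 0 < gap * (gap * F).
    by apply: lt_le_trans h2; rewrite mulr_gt0 // (lt_le_trans ltr01 dmn1).
  have h3 : gap * (gap * (gap * F)) <= 32^-1 * (gap * (gap * F)).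
    by rewrite ler_wpM2r // ltW.
  have h4 : s%:R <= sigma / 4 * n.
    apply: le_trans sle _; apply: ler_pM => //; exact: ltW.
  move: tau_le h4; rewrite -/tau /sigma /tol; lra.
- have CR : #|C|%:R <= M%:R :> R by rewrite ler_nat.
  have -> : (gap * (mu * n)) ^+ 2 = (gap * mu) ^+ 2 * n ^+ 2 by ring.
  apply: (@le_trans _ _ (4 * M%:R * (beta * k) * k)).
    rewrite ler_wpM2r // ?(ltW k0) //.
    by apply: ler_pM => //; rewrite ?mulr_ge0 ?ler_wpM2l.
  have -> : 4 * M%:R * (beta * k) * k = 4 * M%:R * beta * k ^+ 2 by ring.
  have Mb0 : 0 <= 4 * M%:R * beta by rewrite mulr_ge0 ?mulr_ge0 // ltW.
  apply: ler_pM => //; first exact: sqr_ge0.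
  by rewrite lerXn2r ?nnegrE // ltW.
- move=> i j rij; rewrite bulkE; have h1 := dact i j rij.
  have h2 := res_le i j rij.
  have h3 := load_le i; set F : R := #|fiber c i|%:R in h1 h2 h3 *.
  have tgt : target gap plan a b i <=
      (1 + 2 * gap) * (cap i + gap / 2 * (mu * n)).
    have c0 : 0 <= (1 + 2 * gap) / N%:R by rewrite divr_ge0 //; lra.
    apply: le_trans (ler_wpM2l c0 h3) _.
    by rewrite le_eqVlt; apply/orP; left; apply/eqP; field; rewrite gt_eqF.
  apply: le_trans (_ : (1 + 2 * gap) * (cap i + gap / 2 * (mu * n)) +
    gap * (mu * n) + gap * F <= _); first by rewrite 2!lerD2r.
  have F0 : 0 <= F by [].
  have q1 := mulr_ge0 (ltW d0) F0; have q2 := mulr_ge0 (ltW d0) q1.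
  have q3 : gap * (gap * (mu * n)) <= gap * (gap * F).
    by rewrite ler_wpM2l // ltW.
  by move: h1 h2 q1 q2 q3; rewrite /cap -/F; lra.
exists g; first by move=> x y; apply: (partial_inj pg); rewrite inE.
have edge x y : adj x y -> p x = y -> adj (g x) (g y).
  move=> xy pxy; have xr : x != rt.
    apply: contraTneq xy => xr; have [pr _ _] := rtd.
    by rewrite -pxy xr pr adj_irrefl.
  by rewrite adj_sym -pxy; apply: (partial_edge pg) => //; rewrite inE.
move=> x y xy; case: (tedge x y xy) => E; first exact: edge.
by rewrite adj_sym; apply: edge E; rewrite adj_sym.
Qed.

End Assembly.

(** * Reduction to [eta] at most 1 and to trees with an edge *)

Theorem theorem1p2 (R : realType) (eta : R) (eta_gt0 : 0 < eta) :
  exists (n0 : nat) (gamma : R), 0 < gamma /\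
    forall n k : nat, (n0 < n)%N -> (0 < k)%N ->
    forall G : sgraph, #|G| = n ->
      k%:R + eta * n%:R <= avg_degree R G ->
    forall T : sgraph, is_tree T -> #|T| = k ->
      (max_degree T)%:R <= gamma * k%:R ->
      contains_subgraph G T.
Proof.
(* Capping [eta] weakens the density assumption and makes [gap] at most 1/32. *)
pose eta' := Num.min eta 1.
have e0 : 0 < eta' by rewrite lt_min eta_gt0 ltr01.
have e1 : eta' <= 1 by rewrite ge_min lexx orbT.
have ele : eta' <= eta by rewrite ge_min lexx.
have [d0 d1] := gap_bounds e0 e1.
have dE : eta' = 32 * gap eta' by rewrite /gap; field.
have tol0 : 0 < tol eta' by rewrite divr_gt0 // exprn_gt0.
have tolle : tol eta' <= gap eta' / 12.
  have : gap eta' ^+ 3 <= gap eta'.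
    by rewrite exprS ger_pMr // exprn_ile1 ?ltW //; lra.
  by rewrite /tol; lra.
have [||M [mu [mu0 hostP]]] :=
  @host_exists R eta' (tol eta') (gap eta') e0 tol0 d0.
- by lra.
- by lra.
have [g0 _ _] := gamma_bounds M e0 e1 mu0.
exists 0%N, (gamma eta' mu M); split=> // n k n0 k0 G Gn dense T treeT Tk degT.
have nR : 0 < n%:R :> R by rewrite ltr0n.
have kR : 0 < k%:R :> R by rewrite ltr0n.
have pairs : k%:R * n%:R + eta' * n%:R ^+ 2 <= \sum_z edge_ind R (@adj G) z.
  apply: le_trans (edges_le_pairs R G).
  move: dense; rewrite /avg_degree Gn ler_pdivlMr // => dense.
  have := ler_wpM2r (sqr_ge0 (n%:R : R)) ele; lra.
(* A single vertex has no edge to force [gamma * k] to be at least 1, so it is placed directly. *)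
have [k1|k1] := leqP k 1.
  have [v0 _] : exists v0 : G, v0 \in G by apply/card_gt0P; rewrite Gn.
  have one (x y : T) : x = y.
    by apply: (card_le1_eqP (A := T)) => //; rewrite Tk.
  exists (fun=> v0) => [x y _|x y]; first exact: one.
  by rewrite (one x y) adj_irrefl.
have kn : (k <= n)%N.
  rewrite -(ler_nat R) -(ler_pM2r nR).
  have : \sum_z edge_ind R (@adj G) z <= n%:R ^+ 2.
    rewrite -natrX -Gn -mulnn -card_prod -sum1_card natr_sum.
    apply: ler_sum => z _.
    by case/andP: (edge_ind01 R (@adj G) z).
  by have := mulr_ge0 (ltW e0) (sqr_ge0 (n%:R : R)); lra.
subst n k.
have [C [c [r [i0 [CM h]]]]] :=
  hostP G (@adj G) #|T|%:R (@adj_sym G) n0 kR pairs.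
exact: (embed_in_host e0 e1 mu0 CM kn k1 treeT degT h).
Qed.
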